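(* Let $\Omega, I \subset \mathbb{R}$ be open intervals containing $0$ and let $f : \Omega \times I \to \mathbb{R}$, $$f(x;\mu) = \begin{cases} f_L(x;\mu), & x \le 0, \\ f_R(x;\mu), & x \ge 0, \end{cases}$$ be piecewise-$C^2$ with $f_L(0;\mu) = f_R(0;\mu)$ for all $\mu \in I$ and $f_L(0;0) = f_R(0;0) = 0$. Let $a_L = \frac{\partial f_L}{\partial x}(0;0)$, $a_R = \frac{\partial f_R}{\partial x}(0;0)$ and $\beta = \frac{\partial f_L}{\partial \mu}(0;0) = \frac{\partial f_R}{\partial \mu}(0;0)$. Suppose $\beta > 0$, $(a_L-1)(a_R-1) > 0$, $(a_L+1)(a_R+1) > 0$, $a_L \ne 0$, and $a_R \ne 0$. Let $\nu(\mu) = f(0;\mu)$, and for $\nu, s_L, s_R, t \in \mathbb{R}$ let $$g(y;\nu,s_L,s_R,t) = \begin{cases} \nu + s_L y + t y^2, & y \le 0, \\ \nu + s_R y, & y \ge 0. \end{cases}$$ Then there exist $\mu_0 > 0$, continuous functions $s_L(\mu) = a_L + O(\mu)$ and $s_R(\mu) = a_R + O(\mu)$, and neighbourhoods $N$ and $M(\mu)$ of $0$, such that $f(x;\mu)$ on $N$ and $\tilde{g}(y;\mu) = g(y;\nu(\mu),s_L(\mu),s_R(\mu),0)$ on $M(\mu)$ are differentiably conjugate for all $\mu \in (-\mu_0,\mu_0)$. Moreover, for any $\delta > 0$ we can choose $\mu_0 > 0$, $N = (-p,p)$, and $M(\mu) = (q^-(\mu),q^+(\mu))$ so that $$(1-\delta)\,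 p < \left| q^\pm(\mu) \right| < (1+\delta)\, p$$ for all $\mu \in (-\mu_0,\mu_0)$.
   Context: Piecewise-$C^k$: $f_L$ (defined for $x \le 0$) and $f_R$ (defined for $x \ge 0$) are $C^k$ functions of $(x;\mu)$ that can be extended as $C^k$ functions to a neighbourhood of $x=0$, so their derivatives at $x=0$ are well-defined. Conjugacy: let $F : \Omega \to \mathbb{R}$ and $G : \Psi \to \mathbb{R}$ be continuous maps on open intervals, $U \subset \Omega$, $V \subset \Psi$. Then $F$ on $U$ and $G$ on $V$ are topologically conjugate if there is a homeomorphism $h : U \to V$ such that $h(F(x)) = G(h(x))$ for all $x \in U$ for which $F(x) \in U$. If $h$ is also a diffeomorphism ($C^1$ with $C^1$ inverse), then $F$ on $U$ and $G$ on $V$ are differentiably conjugate. (Here, for each fixed $\mu$, $F = f(\cdot\,;\mu)$ and $G = \tilde g(\cdot\,;\mu)$; the neighbourhood $N$ does not depend on $\mu$, and neighbourhoods of $0$ are open intervals containing $0$.) *)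

(* Defs.v *)
From Stdlib Require Import Reals.
From Coquelicot Require Import Coquelicot.

Open Scope R_scope.

(* Possibly unbounded. *)
Definition is_open_interval (S : R -> Prop) : Prop :=
  exists a b : Rbar, forall x : R, S x <-> Rbar_lt a x /\ Rbar_lt x b.

(* Since [W] is open, [ex_diff_n f k] at all points of [W] means that all
   partial derivatives up to order [k] exist and are continuous on [W]. *)
Definition Ck_on_nbhd (k : nat) (D : R -> R -> Prop) (f : R -> R -> R) : Prop :=
  exists W : R -> R -> Prop,
    (forall x mu, W x mu -> locally_2d W x mu) /\
    (forall x mu, D x mu -> W x mu) /\
    (forall x mu, W x mu -> ex_diff_n f k x mu).

(* [fL] and [fR] stand for the C^k extensions across [x = 0] of the two pieces;
   their values and derivatives on [x <= 0], resp. [x >= 0], do not depend on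
   the extension chosen. *)
Definition piecewise_Ck (k : nat) (Omega J : R -> Prop)
    (fL fR f : R -> R -> R) : Prop :=
  Ck_on_nbhd k (fun x mu => Omega x /\ J mu /\ x <= 0) fL /\
  Ck_on_nbhd k (fun x mu => Omega x /\ J mu /\ 0 <= x) fR /\
  (forall x mu, Omega x -> J mu -> x <= 0 -> f x mu = fL x mu) /\
  (forall x mu, Omega x -> J mu -> 0 <= x -> f x mu = fR x mu).

Definition is_bigO (F : (R -> Prop) -> Prop) (u v : R -> R) : Prop :=
  exists C : R, F (fun x => Rabs (u x) <= C * Rabs (v x)).

(* In the next three definitions [U] and [V] are meant to be open, so that
   continuity and differentiability at the points of [U] only depend on the
   values on [U]. *)
Definition homeomorphism (U V : R -> Prop) (h k : R -> R) : Prop :=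
  (forall x, U x -> V (h x) /\ k (h x) = x) /\
  (forall y, V y -> U (k y) /\ h (k y) = y) /\
  (forall x, U x -> continuous h x) /\
  (forall y, V y -> continuous k y).

Definition C1_on (U : R -> Prop) (h : R -> R) : Prop :=
  forall x, U x -> ex_derive h x /\ continuous (Derive h) x.

Definition differentiably_conjugate
    (F : R -> R) (U : R -> Prop) (G : R -> R) (V : R -> Prop) : Prop :=
  exists h k : R -> R,
    homeomorphism U V h k /\ C1_on U h /\ C1_on V k /\
    (forall x, U x -> U (F x) -> h (F x) = G (h x)).

Definition g (y nu sL sR t : R) : R :=
  if Rle_dec y 0 then nu + sL * y + t * y ^ 2 else nu + sR * y.

(* Main.v *)
(** At the kink the derivative of [f] jumps by the factor [AL 0 / AR 0]. Choosing
    [sL / sR] equal to it makes the quotient [D] of the slopes of [f] and of the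
    normal form continuous (even Lipschitz) across [0]; the remaining common factor
    of [sL] and [sR] is fixed by [D xs = 1] at the fixed point [xs] of [f]. A
    conjugacy [h] with [h 0 = 0] must satisfy [h' x = D x * h' (f x)] and
    [h nu = nu]. Taking logarithms, [S = ln h'] (up to a constant) solves the
    cohomological equation [S x = ln (D x) + S (f x)]. The hypotheses on [aL] and
    [aR] say that [f] is a contraction or an invertible expansion, so that the sum
    of [ln D] along forward, resp. backward, orbits converges geometrically to a
    Lipschitz solution, with a constant independent of [mu] and of the neighbourhood
    [(-p, p)]. Hence [h'] is within [exp (O(p))] of [1] on [(-p, p)], uniformly in
    [mu], which is the bound on [M]. *)
Require Import Defs.
From Stdlib Require Import Reals Lra ClassicalEpsilon Ranalysis5.
From Coquelicot Require Import Coquelicot.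
Open Scope R_scope.


(** * Lipschitz functions and the cohomological equation for a contraction *)

(** By symmetry [b <= a]; then [ln a - ln b = ln (1 + (a - b) / b)], and [1 + t <= exp t] bounds
    this by [(a - b) / b]. *)
Lemma ln_lipschitz (m a b : R) : 0 < m -> m <= a -> m <= b ->
  Rabs (ln a - ln b) <= Rabs (a - b) / m.
Proof.
  assert (H : forall a b, 0 < m -> m <= b -> b <= a ->
    Rabs (ln a - ln b) <= Rabs (a - b) / m).
  { clear; intros a b Hm Hb Hba.
    assert (Hln : ln b <= ln a) by (apply ln_le; lra).
    rewrite !Rabs_pos_eq by lra.
    assert (E : a = b * (1 + (a - b) / b)) by (field; lra).
    assert (H0 : 0 <= (a - b) / b) by (apply Rdiv_le_0_compat; lra).
    assert (ln a - ln b = ln (1 + (a - b) / b)).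
    { rewrite E at 1. rewrite ln_mult by lra. ring. }
    rewrite H. apply Rle_trans with ((a - b) / b).
    - rewrite <- (ln_exp ((a - b) / b)) at 2.
      apply ln_le; [lra|apply exp_ineq1_le].
    - apply Rmult_le_compat_l; [lra|]. apply Rinv_le_contravar; lra. }
  intros Hm Ha Hb. destruct (Rle_dec b a).
  - now apply H.
  - rewrite Rabs_minus_sym, (Rabs_minus_sym a). apply H; lra.
Qed.

Definition lipschitz (k : R) (f : R -> R) : Prop :=
  forall x y, Rabs (f x - f y) <= k * Rabs (x - y).

Lemma lipschitz_continuous (k : R) (f : R -> R) (x : R) :
  lipschitz k f -> continuous f x.
Proof.
  intros Hf. apply filterlim_locally. intros eps.
  (* [lipschitz] puts no sign on [k], so the modulus of continuity divides by [Rabs k + 1], which is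
     positive. *)
  assert (Hk : 0 < Rabs k + 1) by (pose proof (Rabs_pos k); lra).
  exists (mkposreal _ (Rdiv_lt_0_compat _ _ (cond_pos eps) Hk)).
  intros y Hy. change (Rabs (y - x) < eps / (Rabs k + 1)) in Hy.
  change (Rabs (f y - f x) < eps).
  apply Rle_lt_trans with ((Rabs k + 1) * Rabs (y - x)).
  - apply Rle_trans with (1 := Hf y x).
    apply Rmult_le_compat_r; [apply Rabs_pos|]. pose proof (Rle_abs k); lra.
  - apply Rmult_lt_reg_r with (/ (Rabs k + 1)).
    + now apply Rinv_0_lt_compat.
    + replace ((Rabs k + 1) * Rabs (y - x) * / (Rabs k + 1)) with (Rabs (y - x))
        by (field; lra). exact Hy.
Qed.

(** [S] is the sum of [v] along the forward orbit, and splitting off its first term gives the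
    equation. Orbits approach [xs] like [rho ^ n] and [v xs = 0], so the series converges
    geometrically; comparing two orbits term by term gives the Lipschitz constant [kappa] times the
    sum of the powers of [rho]. *)
Lemma coboundary (T v : R -> R) (rho kappa xs : R) :
  0 <= rho < 1 -> 0 <= kappa -> lipschitz rho T -> T xs = xs ->
  lipschitz kappa v -> v xs = 0 ->
  exists S : R -> R, (forall x, S x = v x + S (T x)) /\
    lipschitz (kappa / (1 - rho)) S.
Proof.
  intros Hrho Hk HT Hxs Hv Hvxs.
  set (it := fun (n : nat) (x : R) => Nat.iter n T x).
  assert (Hit : forall n x y, Rabs (it n x - it n y) <= rho ^ n * Rabs (x - y)).
  { induction n as [|n IH]; intros x y; simpl.
    - lra.
    - apply Rle_trans with (1 := HT _ _). rewrite Rmult_assoc.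
      apply Rmult_le_compat_l; [lra|]. apply IH. }
  assert (Hvit : forall n x y,
    Rabs (v (it n x) - v (it n y)) <= kappa * Rabs (x - y) * rho ^ n).
  { intros n x y. apply Rle_trans with (1 := Hv _ _).
    rewrite Rmult_assoc. apply Rmult_le_compat_l; [lra|].
    rewrite Rmult_comm with (r2 := rho ^ n). apply Hit. }
  assert (Hg : ex_series (fun n => rho ^ n)).
  { apply ex_series_geom. rewrite Rabs_pos_eq; lra. }
  assert (Hgx : forall c, ex_series (fun n => c * rho ^ n)).
  { intros c. now apply (ex_series_scal (V := R_NormedModule)). }
  assert (Hxsn : forall n, it n xs = xs).
  { induction n as [|n IH]; [reflexivity|]. simpl. now rewrite IH. }
  assert (Hex : forall x, ex_series (fun n => v (it n x))).
  { intros x. apply (ex_series_le (V := R_CompleteNormedModule)) with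
      (b := fun n => kappa * Rabs (x - xs) * rho ^ n).
    - intros n. change (Rabs (v (it n x)) <= kappa * Rabs (x - xs) * rho ^ n).
      specialize (Hvit n x xs). rewrite Hxsn, Hvxs, Rminus_0_r in Hvit. exact Hvit.
    - apply Hgx. }
  exists (fun x => Series (fun n => v (it n x))). split.
  - intros x. rewrite (Series_incr_1 _ (Hex x)). simpl. f_equal.
    apply Series_ext. intros n. f_equal. unfold it.
    change (Nat.iter (S n) T x = Nat.iter n T (T x)). apply Nat.iter_succ_r.
  - intros x y. rewrite <- Series_minus by apply Hex.
    assert (Habs : ex_series (fun n => Rabs (v (it n x) - v (it n y)))).
    { apply (ex_series_le (V := R_CompleteNormedModule)) with
        (b := fun n => kappa * Rabs (x - y) * rho ^ n).
      - intros n. change (Rabs (Rabs (v (it n x) - v (it n y)))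
          <= kappa * Rabs (x - y) * rho ^ n).
        rewrite Rabs_Rabsolu. apply Hvit.
      - apply Hgx. }
    apply Rle_trans with (1 := Series_Rabs _ Habs).
    apply Rle_trans with (Series (fun n => kappa * Rabs (x - y) * rho ^ n)).
    + apply Series_le; [|apply Hgx]. intros n. split; [apply Rabs_pos|apply Hvit].
    + rewrite Series_scal_l, Series_geom by (rewrite Rabs_pos_eq; lra).
      apply Req_le. field. lra.
Qed.

(** * Inverse functions and antiderivatives *)

Lemma inverse_of_expansion (F : R -> R) (tau : R) :
  0 < tau -> (forall x, continuous F x) ->
  (forall x y, x <= y -> tau * (y - x) <= F y - F x) ->
  exists phi : R -> R, (forall y, F (phi y) = y) /\ (forall x, phi (F x) = x) /\
    lipschitz (/ tau) phi.
Proof.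
  intros Htau Hc HF.
  assert (Hsurj : forall y, exists x, F x = y).
  (* Growth at rate [tau] over a distance [d] from [0] covers the gap between [F 0] and [y], so [F]
     takes the value [y] on [[-d, d]]. *)
  { intros y. set (d := Rabs (y - F 0) / tau).
    assert (Hd : tau * d = Rabs (y - F 0)) by (unfold d; field; lra).
    assert (Hd0 : 0 <= d) by (apply Rdiv_le_0_compat; [apply Rabs_pos|lra]).
    destruct (IVT_gen F (- d) d y) as [x [_ Hx]].
    - intros x. apply continuity_pt_filterlim, Hc.
    - pose proof (HF 0 d Hd0). pose proof (HF (- d) 0 ltac:(lra)).
      pose proof (Rle_abs (y - F 0)). pose proof (Rle_abs (- (y - F 0))).
      rewrite Rabs_Ropp in H2.
      rewrite Rmin_left, Rmax_right; lra.
    - now exists x. }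
  set (phi := fun y => proj1_sig (constructive_indefinite_description _ (Hsurj y))).
  assert (Hphi : forall y, F (phi y) = y)
    by (intros y; unfold phi; now destruct (constructive_indefinite_description _ _)).
  assert (Hexp : forall x y, tau * Rabs (x - y) <= Rabs (F x - F y)).
  { intros x y. destruct (Rle_dec x y) as [H|H].
    - rewrite Rabs_minus_sym, (Rabs_minus_sym (F x)), Rabs_pos_eq by lra.
      apply Rle_trans with (2 := Rle_abs _). now apply HF.
    - rewrite Rabs_pos_eq by lra.
      apply Rle_trans with (2 := Rle_abs _). apply HF; lra. }
  exists phi. split; [exact Hphi|split].
  - intros x. pose proof (Hexp (phi (F x)) x) as H.
    rewrite Hphi, Rminus_diag, Rabs_R0 in H.
    destruct (Req_dec (phi (F x)) x) as [E|E]; [exact E|].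
    assert (0 < Rabs (phi (F x) - x)) by (apply Rabs_pos_lt; lra). nra.
  - intros x y. apply Rmult_le_reg_l with tau; [lra|].
    rewrite <- Rmult_assoc, Rinv_r, Rmult_1_l by lra.
    rewrite <- (Hphi x) at 2. rewrite <- (Hphi y) at 2. apply Hexp.
Qed.

Lemma increment (h P : R -> R) (a b : R) :
  (forall x, is_derive h x (P x)) ->
  exists c, Rmin a b <= c <= Rmax a b /\ h b - h a = P c * (b - a).
Proof.
  intros Hh. apply MVT_gen; intros x _; [apply Hh|].
  apply continuity_pt_filterlim, (ex_derive_continuous (V := R_NormedModule)).
  now exists (P x).
Qed.

(** A positive derivative makes [h] strictly increasing, so it maps [(a, b)] onto [(h a, h b)]. The
    inverse has the derivative [/ P (k y)], which is continuous because [k] and [P] are. *)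
Lemma C1_increasing_diffeo (h P : R -> R) (a b : R) :
  (forall x, is_derive h x (P x)) -> (forall x, continuous P x) ->
  (forall x, 0 < P x) -> a < b ->
  exists k : R -> R,
    homeomorphism (open_interval a b) (open_interval (h a) (h b)) h k /\
    C1_on (open_interval a b) h /\ C1_on (open_interval (h a) (h b)) k.
Proof.
  intros Hh HP HPpos Hab.
  assert (Hinc : forall x y, x < y -> h x < h y).
  { intros x y Hxy. destruct (increment h P x y Hh) as [c [_ Hc]].
    pose proof (HPpos c). nra. }
  assert (Hrefl : forall x y, h x < h y -> x < y).
  { intros x y Hxy. destruct (Rtotal_order x y) as [H|[H|H]]; [exact H| |].
    - subst. lra.
    - apply Hinc in H. lra. }
  assert (Hinj : forall x y, h x = h y -> x = y).
  { intros x y E. destruct (Rtotal_order x y) as [H|[H|H]]; [|exact H|];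
      apply Hinc in H; lra. }
  assert (Hhc : forall x, continuous h x).
  { intros x. apply (ex_derive_continuous (V := R_NormedModule)). now exists (P x). }
  (* The range condition sits under the existential so that choice yields a total [k]; outside
     [[h a, h b]] its value is arbitrary. *)
  assert (Hsurj : forall y, exists x, h a <= y <= h b -> a <= x <= b /\ h x = y).
  { intros y. destruct (Rle_dec (h a) y); [destruct (Rle_dec y (h b))|];
      [|exists 0; lra|exists 0; lra].
    pose proof (Hinc a b Hab).
    destruct (IVT_gen h a b y) as [x [Hx Hxy]].
    - intros x. apply continuity_pt_filterlim, Hhc.
    - rewrite Rmin_left, Rmax_right; lra.
    - rewrite Rmin_left, Rmax_right in Hx by lra. now exists x. }
  set (k := fun y => proj1_sig (constructive_indefinite_description _ (Hsurj y))).
  assert (Hk : forall y, h a <= y <= h b -> a <= k y <= b /\ h (k y) = y)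
    by (intros y; unfold k; now destruct (constructive_indefinite_description _ _)).
  clearbody k.
  assert (Hko : forall y, h a < y < h b -> a < k y < b).
  { intros y Hy. destruct (Hk y) as [_ E]; [lra|]. split; apply Hrefl; lra. }
  assert (Hkc : forall y, h a < y < h b -> continuous k y).
  { intros y Hy. apply continuity_pt_filterlim.
    apply continuity_pt_recip_interv with (f := h) (lb := a) (ub := b).
    - exact Hab.
    - intros; now apply Hinc.
    - intros z ? ?; now apply Hk.
    - intros z ? ?; now apply Hk.
    - intros z _. apply continuity_pt_filterlim, Hhc.
    - exact Hy. }
  assert (Hkd : forall y, h a < y < h b -> is_derive k y (/ P (k y))).
  { intros y Hy. apply is_derive_Reals.
    (* The rule for the derivative of an inverse takes derivability proofs as arguments, on the
       whole interval between the images of the end points under [k]. *)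
    assert (Prf : forall z, k (h a) <= z <= k (h b) -> derivable_pt h z).
    { intros z _. exists (P z). apply is_derive_Reals, Hh. }
    assert (Ea : k (h a) = a) by (apply Hinj, Hk; lra).
    assert (Eb : k (h b) = b) by (apply Hinj, Hk; lra).
    assert (Hky : k (h a) <= k y <= k (h b)).
    { rewrite Ea, Eb. apply Hk; lra. }
    assert (Ed : derive_pt h (k y) (Prf (k y) Hky) = P (k y)).
    { apply derive_pt_eq_0, is_derive_Reals, Hh. }
    replace (/ P (k y)) with (1 / derive_pt h (k y) (Prf (k y) Hky)).
    - apply derivable_pt_lim_recip_interv with (lb := h a) (ub := h b).
      + apply continuity_pt_filterlim, Hkc, Hy.
      + lra.
      + exact Hy.
      + intros z Hz. now apply Hk.
      + rewrite Ed. pose proof (HPpos (k y)). lra.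
    - rewrite Ed. field. pose proof (HPpos (k y)). lra. }
  assert (Hloc : forall y, h a < y < h b -> locally y (fun z => h a < z < h b)).
  { intros y Hy. apply (locally_interval _ y (h a) (h b)); simpl; tauto. }
  exists k. unfold open_interval. repeat split.
  - now apply Hinc.
  - now apply Hinc.
  - apply Hinj, Hk. pose proof (Hinc a x (proj1 H)). pose proof (Hinc x b (proj2 H)). lra.
  - now apply Hko.
  - now apply Hko.
  - apply Hk; lra.
  - intros; apply Hhc.
  - exact Hkc.
  - now exists (P x).
  - apply continuous_ext with P; [|apply HP].
    intros z. symmetry. apply is_derive_unique, Hh.
  - exists (/ P (k x)). now apply Hkd.
  - apply continuous_ext_loc with (fun y => / P (k y)).
    + apply filter_imp with (2 := Hloc x H).
      intros z Hz. symmetry. now apply is_derive_unique, Hkd.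
    + apply continuous_comp with (f := fun y => P (k y)) (g := Rinv).
      * apply continuous_comp; [now apply Hkc|apply HP].
      * apply continuity_pt_filterlim, continuity_pt_inv.
        -- apply continuity_pt_id.
        -- pose proof (HPpos (k x)). lra.
Qed.

Lemma antiderivative (P : R -> R) : (forall x, continuous P x) ->
  exists H : R -> R, H 0 = 0 /\ forall x, is_derive H x (P x).
Proof.
  intros HP. exists (RInt P 0). split.
  - apply (RInt_point (V := R_CompleteNormedModule)).
  - intros x. apply (is_derive_RInt (V := R_NormedModule)) with 0; [|apply HP].
    apply filter_forall. intros y. apply (RInt_correct (V := R_CompleteNormedModule)).
    apply (ex_RInt_continuous (V := R_CompleteNormedModule)). intros z _. apply HP.
Qed.

Lemma null_derivative (h : R -> R) (x y : R) :
  (forall z, Rmin x y <= z <= Rmax x y -> is_derive h z 0) -> h y = h x.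
Proof.
  intros Hh. destruct (MVT_gen h x y (fun _ => 0)) as [c [_ Hc]].
  - intros z Hz. apply Hh. lra.
  - intros z Hz. apply continuity_pt_filterlim, (ex_derive_continuous (V := R_NormedModule)).
    exists 0. now apply Hh.
  - lra.
Qed.

(** * The normal form and the conjugacy obtained from a solution of the cohomological equation *)

Lemma g_nonpos (y nu sL sR : R) : y <= 0 -> g y nu sL sR 0 = nu + sL * y.
Proof. intros Hy. unfold g. destruct (Rle_dec y 0); [ring|lra]. Qed.

Lemma g_nonneg (y nu sL sR : R) : 0 <= y -> g y nu sL sR 0 = nu + sR * y.
Proof.
  intros Hy. unfold g. destruct (Rle_dec y 0); [|ring].
  replace y with 0 by lra. ring.
Qed.

Lemma increasing_sign (I A : R -> R) (x : R) :
  I 0 = 0 -> (forall x, is_derive I x (A x)) -> (forall x, 0 < A x) ->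
  (x <= 0 -> I x <= 0) /\ (0 <= x -> 0 <= I x).
Proof.
  intros H0 HI HA. destruct (increment I A 0 x HI) as [c [_ Hc]].
  pose proof (HA c). rewrite H0 in Hc. split; intros Hx; nra.
Qed.

(* The kink of [F] at [0] is absorbed in the factor [sL] or [sR]: [exp u] is the
   same continuous function on both sides, so [exp S] can serve as [h'] up to a
   constant, which is fixed by the requirement [h nu = nu]. *)
Lemma conjugacy_of_cocycle (I u S : R -> R) (nu sL sR : R) :
  I 0 = 0 -> (forall x, is_derive I x (exp (u x))) ->
  (forall x, continuous S x) ->
  (forall x, S x = u x + S (g (I x) nu sL sR 0)) ->
  exists (h : R -> R) (xi : R), Rabs xi <= Rabs nu /\ h 0 = 0 /\
    (forall x, is_derive h x (exp (S x - S xi))) /\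
    (forall x, h (g (I x) nu sL sR 0) = g (h x) nu sL sR 0).
Proof.
  intros I0 HI HSc HS.
  assert (HeS : forall x, continuous (fun x => exp (S x)) x).
  { intros x. apply continuous_comp; [apply HSc|].
    apply continuity_pt_filterlim, derivable_continuous_pt, derivable_pt_exp. }
  destruct (antiderivative _ HeS) as [H [H0 HH]].
  (* The mean value [exp (S xi)] satisfies [H nu = exp (S xi) * nu]. Dividing [H] by it gives
     [h nu = nu], and this also covers [nu = 0]. *)
  destruct (increment H _ 0 nu HH) as [xi [Hxi Hnu]].
  rewrite H0, !Rminus_0_r in Hnu.
  set (h := fun x => exp (- S xi) * H x).
  assert (Hh : forall x, is_derive h x (exp (S x - S xi))).
  { intros x. replace (exp (S x - S xi)) with (exp (- S xi) * exp (S x))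
      by (rewrite <- exp_plus; f_equal; ring).
    apply is_derive_scal, HH. }
  assert (h0 : h 0 = 0) by (unfold h; rewrite H0; ring).
  assert (hnu : h nu = nu).
  { unfold h. rewrite Hnu, <- Rmult_assoc, <- exp_plus, Rplus_opp_l, exp_0. ring. }
  clearbody h. clear H H0 HH Hnu HeS.
  assert (Hexp : forall x, 0 < exp (u x)) by (intros; apply exp_pos).
  assert (Hexp' : forall x, 0 < exp (S x - S xi)) by (intros; apply exp_pos).
  (* On a side where [g] has slope [s], the function [h (nu + s * I x) - s * h x] has derivative
     zero: by the equation for [S], [exp (u x)] times [h'] at the image is [h' x]. At [0] the
     function equals [h nu = nu]. *)
  assert (Hside : forall s x,
    (forall z, Rmin 0 x <= z <= Rmax 0 x -> g (I z) nu sL sR 0 = nu + s * I z) ->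
    h (nu + s * I x) = nu + s * h x).
  { intros s x Hs.
    assert (E : h (nu + s * I x) - s * h x = h (nu + s * I 0) - s * h 0).
    { apply (null_derivative (fun x => h (nu + s * I x) - s * h x)). intros z Hz.
      assert (D : is_derive (fun z => nu + s * I z) z (s * exp (u z))).
      { auto_derive.
        - exists (exp (u z)). apply HI.
        - change (fun x : R => I x) with I.
          rewrite (is_derive_unique _ _ _ (HI z)). ring. }
      pose proof (is_derive_comp h _ z _ _ (Hh _) D) as D'.
      assert (D'' : is_derive (fun x => s * h x) z (s * exp (S z - S xi)))
        by apply is_derive_scal, Hh.
      pose proof (is_derive_minus _ _ _ _ _ D' D'') as D3.
      match type of D3 with is_derive _ _ ?d => replace 0 with d end; [exact D3|].
      unfold minus, plus, opp, scal; simpl; unfold mult; simpl.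
      rewrite <- (Hs z Hz), (HS z).
      replace (u z + S (g (I z) nu sL sR 0) - S xi)
        with (u z + (S (g (I z) nu sL sR 0) - S xi)) by ring.
      rewrite exp_plus. ring. }
    rewrite I0, h0, Rmult_0_r, Rplus_0_r, hnu in E. lra. }
  exists h, xi. split; [|split; [exact h0|split; [exact Hh|]]].
  - revert Hxi. unfold Rmin, Rmax. destruct (Rle_dec 0 nu); intros Hxi.
    + rewrite !Rabs_pos_eq; lra.
    + rewrite !Rabs_left1; lra.
  (* [I] and [h] increase and vanish at [0], so [x], [I x] and [h x] lie on the same side of the
     kink and [g] uses the same branch at both arguments. *)
  - intros x. destruct (Rle_dec x 0) as [Hx|Hx].
    + rewrite !g_nonpos.
      * apply Hside. intros z Hz. rewrite Rmax_left in Hz by lra.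
        apply g_nonpos, (increasing_sign I _ z I0 HI Hexp). lra.
      * now apply (increasing_sign h _ x h0 Hh Hexp').
      * now apply (increasing_sign I _ x I0 HI Hexp).
    + rewrite !g_nonneg.
      * apply Hside. intros z Hz. rewrite Rmin_left in Hz by lra.
        apply g_nonneg, (increasing_sign I _ z I0 HI Hexp). lra.
      * apply (increasing_sign h _ x h0 Hh Hexp'). lra.
      * apply (increasing_sign I _ x I0 HI Hexp). lra.
Qed.

(** * Slopes of piecewise maps and their logarithms *)

Lemma slope_lower_bound (f A : R -> R) (tau x y : R) : x <= y ->
  (forall z, x <= z <= y -> is_derive f z (A z) /\ tau <= A z) ->
  tau * (y - x) <= f y - f x.
Proof.
  intros Hxy Hf. destruct (MVT_gen f x y A) as [c [Hc E]].
  - intros z. rewrite Rmin_left, Rmax_right by lra. intros Hz. apply Hf; lra.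
  - intros z. rewrite Rmin_left, Rmax_right by lra. intros Hz.
    apply continuity_pt_filterlim, (ex_derive_continuous (V := R_NormedModule)).
    exists (A z). now apply Hf.
  - rewrite Rmin_left, Rmax_right in Hc by lra.
    rewrite E. apply Rmult_le_compat_r; [lra|]. now apply Hf.
Qed.

(** If [0] separates [x] from [y], the one-sided bounds on [[x, 0]] and [[0, y]] add up. Applied to
    [f] times a sign, a lower bound also serves as an upper bound and handles decreasing maps. *)
Lemma piecewise_slope_lower_bound (f fL fR AL AR : R -> R) (tau x y : R) :
  x <= y -> fL 0 = fR 0 ->
  (forall z, x <= z <= y -> z <= 0 ->
    f z = fL z /\ is_derive fL z (AL z) /\ tau <= AL z) ->
  (forall z, x <= z <= y -> 0 <= z ->
    f z = fR z /\ is_derive fR z (AR z) /\ tau <= AR z) ->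
  tau * (y - x) <= f y - f x.
Proof.
  intros Hxy H0 HL HR.
  destruct (Rle_dec y 0) as [Hy|Hy]; [|destruct (Rle_dec 0 x) as [Hx|Hx]].
  - rewrite (proj1 (HL x ltac:(lra) ltac:(lra))), (proj1 (HL y ltac:(lra) ltac:(lra))).
    apply slope_lower_bound with AL; [exact Hxy|]. intros z Hz. apply HL; lra.
  - rewrite (proj1 (HR x ltac:(lra) ltac:(lra))), (proj1 (HR y ltac:(lra) ltac:(lra))).
    apply slope_lower_bound with AR; [exact Hxy|]. intros z Hz. apply HR; lra.
  - rewrite (proj1 (HL x ltac:(lra) ltac:(lra))), (proj1 (HR y ltac:(lra) ltac:(lra))).
    assert (tau * (0 - x) <= fL 0 - fL x).
    { apply slope_lower_bound with AL; [lra|]. intros z Hz. apply HL; lra. }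
    assert (tau * (y - 0) <= fR y - fR 0).
    { apply slope_lower_bound with AR; [lra|]. intros z Hz. apply HR; lra. }
    lra.
Qed.

(** The first alternative is a contraction, whose slopes may have different signs at the kink. The
    second is an expansion by at least [/ rho]; the common sign [sigma] on both sides makes it
    monotone, hence invertible. *)
Definition hyperbolic_slopes (rho : R) (D : R -> Prop) (AL AR : R -> R) : Prop :=
  (forall x, D x -> (x <= 0 -> Rabs (AL x) <= rho) /\ (0 <= x -> Rabs (AR x) <= rho)) \/
  (exists sigma, (sigma = 1 \/ sigma = -1) /\
    forall x, D x -> (x <= 0 -> / rho <= sigma * AL x) /\
                     (0 <= x -> / rho <= sigma * AR x)).

(* For an expansion the series runs along backward orbits. *)
Lemma cocycle_exists (F fL fR AL AR u : R -> R) (rho kappa xs : R) :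
  0 < rho < 1 -> 0 <= kappa -> fL 0 = fR 0 ->
  (forall x, x <= 0 -> F x = fL x) -> (forall x, 0 <= x -> F x = fR x) ->
  (forall x, is_derive fL x (AL x)) -> (forall x, is_derive fR x (AR x)) ->
  (forall x, continuous F x) ->
  hyperbolic_slopes rho (fun _ => True) AL AR ->
  lipschitz kappa u -> F xs = xs -> u xs = 0 ->
  exists S : R -> R, (forall x, S x = u x + S (F x)) /\
    lipschitz (kappa / (1 - rho)) S.
Proof.
  intros Hrho Hk H0 HFL HFR HL HR HFc Hhyp Hu Hxs Huxs.
  assert (Hexp : forall s tau,
    (forall x, (x <= 0 -> tau <= s * AL x) /\ (0 <= x -> tau <= s * AR x)) ->
    forall x y, x <= y -> tau * (y - x) <= s * F y - s * F x).
  { intros s tau Hs x y Hxy.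
    apply (piecewise_slope_lower_bound (fun x => s * F x) (fun x => s * fL x)
      (fun x => s * fR x) (fun x => s * AL x) (fun x => s * AR x)); [exact Hxy| | |].
    - now rewrite H0.
    - intros z _ Hz. split; [|split].
      + now rewrite HFL.
      + apply is_derive_scal, HL.
      + now apply Hs.
    - intros z _ Hz. split; [|split].
      + now rewrite HFR.
      + apply is_derive_scal, HR.
      + now apply Hs. }
  destruct Hhyp as [Hc|[sigma [Hsigma He]]].
  (* Both [F] and [-F] have slopes at least [- rho], which bounds the increments of [F] from both
     sides. *)
  - assert (HF : lipschitz rho F).
    { assert (HF : forall x y, x <= y -> Rabs (F x - F y) <= rho * Rabs (x - y)).
      { intros x y Hxy.
        assert (- rho * (y - x) <= 1 * F y - 1 * F x).
        { apply Hexp; [|exact Hxy]. intros z. destruct (Hc z I) as [H1 H2].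
          split; intros Hz; [specialize (H1 Hz); apply Rabs_le_between in H1
            |specialize (H2 Hz); apply Rabs_le_between in H2]; lra. }
        assert (- rho * (y - x) <= -1 * F y - -1 * F x).
        { apply Hexp; [|exact Hxy]. intros z. destruct (Hc z I) as [H1 H2].
          split; intros Hz; [specialize (H1 Hz); apply Rabs_le_between in H1
            |specialize (H2 Hz); apply Rabs_le_between in H2]; lra. }
        rewrite (Rabs_left1 (x - y)) by lra. apply Rabs_le. lra. }
      intros x y. destruct (Rle_dec x y) as [Hxy|Hxy]; [now apply HF|].
      rewrite Rabs_minus_sym, (Rabs_minus_sym x). apply HF. lra. }
    destruct (coboundary F u rho kappa xs) as [S HS]; try assumption; [lra|].
    now exists S.
  - destruct (inverse_of_expansion (fun x => sigma * F x) (/ rho)) as [phi [H1 [H2 H3]]].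
    + apply Rinv_0_lt_compat; lra.
    + intros x. apply (continuous_scal_r (V := R_NormedModule)), HFc.
    + apply Hexp. intros x. now apply He.
    + rewrite Rinv_inv in H3.
      assert (Hss : forall x, sigma * (sigma * x) = x)
        by (intros x; destruct Hsigma as [->| ->]; ring).
      assert (Habs : Rabs sigma = 1)
        by (destruct Hsigma as [->| ->]; unfold Rabs; destruct Rcase_abs; lra).
      assert (Hphi : forall x, phi (sigma * F x) = x) by exact H2.
      (* Since [sigma] is its own inverse, [phi (sigma * y)] is the inverse of [F]. The equation at
         [x] is read at [y = F x] as [S y = - u x + S x], a coboundary equation for this
         contraction. *)
      destruct (coboundary (fun y => phi (sigma * y)) (fun y => - u (phi (sigma * y)))
        rho kappa xs) as [S [HS HSL]].
      * lra.
      * exact Hk.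
      * intros x y. apply Rle_trans with (1 := H3 _ _).
        rewrite <- Rmult_minus_distr_l, Rabs_mult.
        rewrite Habs. lra.
      * rewrite <- Hxs at 1. apply Hphi.
      * intros x y.
        replace (- u (phi (sigma * x)) - - u (phi (sigma * y)))
          with (u (phi (sigma * y)) - u (phi (sigma * x))) by ring.
        rewrite Rabs_minus_sym. apply Rle_trans with (1 := Hu _ _).
        apply Rmult_le_compat_l; [exact Hk|]. apply Rle_trans with (1 := H3 _ _).
        rewrite <- Rmult_minus_distr_l, Rabs_mult.
        pose proof (Rabs_pos (x - y)).
        rewrite Habs. nra.
      * rewrite <- Hxs at 1. rewrite Hphi, Huxs. ring.
      * exists S. split; [|exact HSL]. intros x. rewrite (HS (F x)), Hphi. ring.
Qed.

(* [ln] of the jump-corrected slope of the map at [x]: only the summand of the side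
   containing [x] is nonzero. *)
Definition log_slope (AL AR : R -> R) (x : R) : R :=
  (ln (Rabs (AL (Rmin x 0))) - ln (Rabs (AL 0))) +
  (ln (Rabs (AR (Rmax x 0))) - ln (Rabs (AR 0))).

(** Truncation at [0] does not increase distances and [ln] has Lipschitz constant [/ m] above [m],
    so each of the two summands contributes [K / m]. *)
Lemma log_slope_lipschitz (AL AR : R -> R) (m K p x y : R) : 0 < m -> 0 <= K ->
  (forall x, -p <= x <= p -> m <= Rabs (AL x) /\ m <= Rabs (AR x)) ->
  (forall x y, -p <= x <= p -> -p <= y <= p ->
    Rabs (AL x - AL y) <= K * Rabs (x - y) /\
    Rabs (AR x - AR y) <= K * Rabs (x - y)) ->
  -p <= x <= p -> -p <= y <= p ->
  Rabs (log_slope AL AR x - log_slope AL AR y) <= 2 * K / m * Rabs (x - y).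
Proof.
  intros Hm HK Hlow Hlip Hx Hy.
  assert (H : forall A a b, (forall x, -p <= x <= p -> m <= Rabs (A x)) ->
    -p <= a <= p -> -p <= b <= p -> Rabs (A a - A b) <= K * Rabs (a - b) ->
    Rabs (a - b) <= Rabs (x - y) ->
    Rabs (ln (Rabs (A a)) - ln (Rabs (A b))) <= K / m * Rabs (x - y)).
  { intros A a b HA Ha Hb HAL Hab.
    apply Rle_trans with (1 := ln_lipschitz m _ _ Hm (HA a Ha) (HA b Hb)).
    unfold Rdiv. rewrite Rmult_assoc, (Rmult_comm (/ m)), <- Rmult_assoc.
    apply Rmult_le_compat_r; [now apply Rlt_le, Rinv_0_lt_compat|].
    apply Rle_trans with (1 := Rabs_triang_inv2 _ _).
    apply Rle_trans with (1 := HAL). now apply Rmult_le_compat_l. }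
  assert (Hmin : Rabs (Rmin x 0 - Rmin y 0) <= Rabs (x - y)).
  { unfold Rmin. destruct (Rle_dec x 0), (Rle_dec y 0);
      unfold Rabs; repeat destruct Rcase_abs; lra. }
  assert (Hmax : Rabs (Rmax x 0 - Rmax y 0) <= Rabs (x - y)).
  { unfold Rmax. destruct (Rle_dec x 0), (Rle_dec y 0);
      unfold Rabs; repeat destruct Rcase_abs; lra. }
  assert (Rmin_in : forall z, -p <= z <= p -> -p <= Rmin z 0 <= p)
    by (intros z Hz; unfold Rmin; destruct (Rle_dec z 0); lra).
  assert (Rmax_in : forall z, -p <= z <= p -> -p <= Rmax z 0 <= p)
    by (intros z Hz; unfold Rmax; destruct (Rle_dec z 0); lra).
  unfold log_slope.
  match goal with |- Rabs (?a - ?b + (?c - ?d) - (?a' - _ + (?c' - _))) <= _ =>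
    replace (a - b + (c - d) - (a' - b + (c' - d))) with ((a - a') + (c - c')) by ring
  end.
  apply Rle_trans with (1 := Rabs_triang _ _).
  replace (2 * K / m * Rabs (x - y)) with (K / m * Rabs (x - y) + K / m * Rabs (x - y))
    by (field; lra).
  apply Rplus_le_compat.
  - apply H; auto; [now apply Hlow|now apply Hlip; auto].
  - apply H; auto; [now apply Hlow|now apply Hlip; auto].
Qed.

(** A slope that keeps its sign has [Rabs (AL x) / Rabs (AL 0) = AL x / AL 0]. Hence the single
    factor [exp (log_slope AL AR x)] recovers the true slope from the kink slope on either side. *)
Lemma log_slope_mult (AL AR : R -> R) (x : R) :
  (x <= 0 -> 0 < AL 0 * AL x -> AR 0 <> 0 -> AL 0 * exp (log_slope AL AR x) = AL x) /\
  (0 <= x -> 0 < AR 0 * AR x -> AL 0 <> 0 -> AR 0 * exp (log_slope AL AR x) = AR x).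
Proof.
  assert (H : forall a b, 0 < a * b -> a * exp (ln (Rabs b) - ln (Rabs a)) = b).
  { intros a b Hab.
    assert (a <> 0) by (intros ->; lra). assert (b <> 0) by (intros ->; lra).
    unfold Rminus. rewrite exp_plus, exp_Ropp, !exp_ln by now apply Rabs_pos_lt.
    unfold Rabs. destruct (Rcase_abs a), (Rcase_abs b); try field; nra. }
  split; intros Hx Hp Hn; unfold log_slope.
  - rewrite Rmin_left, Rmax_right by lra. rewrite Rminus_diag, Rplus_0_r. now apply H.
  - rewrite Rmin_right, Rmax_left by lra. rewrite Rminus_diag, Rplus_0_l. now apply H.
Qed.

(** * The conjugacy for one fixed parameter value *)

Lemma exp_le_of_le (x y : R) : x <= y -> exp x <= exp y.
Proof.
  intros [H| ->]; [now apply Rlt_le, exp_increasing|apply Rle_refl].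
Qed.

Lemma g_lipschitz (nu sL sR : R) :
  lipschitz (Rabs sL + Rabs sR) (fun y => g y nu sL sR 0).
Proof.
  assert (E : forall y, g y nu sL sR 0 = nu + sL * Rmin y 0 + sR * Rmax y 0).
  { intros y. destruct (Rle_dec y 0).
    - rewrite g_nonpos, Rmin_left, Rmax_right by lra. ring.
    - rewrite g_nonneg, Rmin_right, Rmax_left by lra. ring. }
  intros x y. rewrite !E.
  replace (nu + sL * Rmin x 0 + sR * Rmax x 0 - (nu + sL * Rmin y 0 + sR * Rmax y 0))
    with (sL * (Rmin x 0 - Rmin y 0) + sR * (Rmax x 0 - Rmax y 0)) by ring.
  apply Rle_trans with (1 := Rabs_triang _ _). rewrite !Rabs_mult.
  assert (Rabs (Rmin x 0 - Rmin y 0) <= Rabs (x - y)).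
  { unfold Rmin. destruct (Rle_dec x 0), (Rle_dec y 0);
      unfold Rabs; repeat destruct Rcase_abs; lra. }
  assert (Rabs (Rmax x 0 - Rmax y 0) <= Rabs (x - y)).
  { unfold Rmax. destruct (Rle_dec x 0), (Rle_dec y 0);
      unfold Rabs; repeat destruct Rcase_abs; lra. }
  pose proof (Rabs_pos sL). pose proof (Rabs_pos sR). nra.
Qed.

(** On [[-p, p]] the map factors as the normal form after [I], where [I' = exp u]. The factor
    [exp (log_slope AL AR xs)] in [sL] and [sR] is what makes [u] vanish at the fixed point, as
    convergence of the orbit sum requires. The constant [L] is the resulting Lipschitz constant of
    [S = ln h']. *)
Lemma conjugacy_near_kink (f fL fR AL AR : R -> R) (p m K rho nu xs : R) :
  0 < p -> 0 < m -> 0 <= K -> 0 < rho < 1 -> Rabs nu <= p -> -p <= xs <= p ->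
  (forall x, -p <= x <= p -> is_derive fL x (AL x) /\ is_derive fR x (AR x)) ->
  (forall x, -p <= x <= p -> m <= Rabs (AL x) /\ m <= Rabs (AR x)) ->
  (forall x, -p <= x <= p -> 0 < AL 0 * AL x /\ 0 < AR 0 * AR x) ->
  (forall x y, -p <= x <= p -> -p <= y <= p ->
    Rabs (AL x - AL y) <= K * Rabs (x - y) /\
    Rabs (AR x - AR y) <= K * Rabs (x - y)) ->
  hyperbolic_slopes rho (fun x => -p <= x <= p) AL AR ->
  fL 0 = nu -> fR 0 = nu ->
  (forall x, -p <= x <= p -> (x <= 0 -> f x = fL x) /\ (0 <= x -> f x = fR x)) ->
  f xs = xs ->
  let sL := AL 0 * exp (log_slope AL AR xs) in
  let sR := AR 0 * exp (log_slope AL AR xs) in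
  let L := 2 * K / m / (1 - rho) in
  exists qm qp : R, qm < 0 < qp /\
    differentiably_conjugate f (open_interval (-p) p)
      (fun y => g y nu sL sR 0) (open_interval qm qp) /\
    exp (- (2 * L * p)) * p <= Rabs qm <= exp (2 * L * p) * p /\
    exp (- (2 * L * p)) * p <= Rabs qp <= exp (2 * L * p) * p.
Proof.
  intros Hp Hm HK Hrho Hnu Hxs Hder Hlow Hsgn Hlip Hhyp HL0 HR0 Hf Hfix sL sR L.
  (* Clamping to [[-p, p]] extends the map to all of [R] with the same slope bounds. *)
  set (cl := fun x => Rmax (-p) (Rmin p x)).
  assert (Hcl : forall x, -p <= cl x <= p).
  { intros x. unfold cl, Rmax, Rmin. repeat destruct Rle_dec; lra. }
  assert (Hclid : forall x, -p <= x <= p -> cl x = x).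
  { intros x Hx. unfold cl, Rmax, Rmin. repeat destruct Rle_dec; lra. }
  assert (Hcl1 : forall x y, Rabs (cl x - cl y) <= Rabs (x - y)).
  { intros x y. unfold cl, Rmax, Rmin. repeat destruct Rle_dec;
      unfold Rabs; repeat destruct Rcase_abs; lra. }
  assert (Hclneg : forall x, x <= 0 -> cl x <= 0).
  { intros x Hx. unfold cl, Rmax, Rmin. repeat destruct Rle_dec; lra. }
  assert (Hclpos : forall x, 0 <= x -> 0 <= cl x).
  { intros x Hx. unfold cl, Rmax, Rmin. repeat destruct Rle_dec; lra. }
  set (u := fun x => log_slope AL AR (cl x) - log_slope AL AR xs).
  assert (Hk0 : 0 <= 2 * K / m) by (apply Rdiv_le_0_compat; lra).
  assert (Hu : lipschitz (2 * K / m) u).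
  { intros x y. unfold u.
    replace (log_slope AL AR (cl x) - log_slope AL AR xs -
      (log_slope AL AR (cl y) - log_slope AL AR xs))
      with (log_slope AL AR (cl x) - log_slope AL AR (cl y)) by ring.
    apply Rle_trans with (1 := log_slope_lipschitz AL AR m K p _ _ Hm HK Hlow Hlip
      (Hcl x) (Hcl y)).
    now apply Rmult_le_compat_l. }
  assert (Huxs : u xs = 0) by (unfold u; rewrite Hclid by lra; ring).
  assert (HAL0 : AL 0 <> 0).
  { intros E. pose proof (proj1 (Hsgn 0 ltac:(lra))). nra. }
  assert (HAR0 : AR 0 <> 0).
  { intros E. pose proof (proj2 (Hsgn 0 ltac:(lra))). nra. }
  assert (Hexpu : forall x,
    exp (log_slope AL AR xs) * exp (u x) = exp (log_slope AL AR (cl x))).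
  { intros x. rewrite <- exp_plus. f_equal. unfold u. ring. }
  assert (HsL : forall x, x <= 0 -> sL * exp (u x) = AL (cl x)).
  { intros x Hx. unfold sL. rewrite Rmult_assoc, Hexpu.
    apply log_slope_mult; auto. now apply Hsgn. }
  assert (HsR : forall x, 0 <= x -> sR * exp (u x) = AR (cl x)).
  { intros x Hx. unfold sR. rewrite Rmult_assoc, Hexpu.
    apply log_slope_mult; auto. now apply Hsgn. }
  assert (Heu : forall x, continuous (fun x => exp (u x)) x).
  { intros x. apply continuous_comp; [now apply lipschitz_continuous with (2 * K / m)|].
    apply continuity_pt_filterlim, derivable_continuous_pt, derivable_pt_exp. }
  destruct (antiderivative _ Heu) as [I [I0 HI]].
  assert (HIsgn : forall x, (x <= 0 -> I x <= 0) /\ (0 <= x -> 0 <= I x)).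
  { intros x. apply increasing_sign with (fun x => exp (u x)); auto.
    intros; apply exp_pos. }
  assert (HIs : forall s x, is_derive (fun x => nu + s * I x) x (s * exp (u x))).
  { intros s x. auto_derive.
    - exists (exp (u x)). apply HI.
    - change (fun x : R => I x) with I.
      rewrite (is_derive_unique _ _ _ (HI x)). ring. }
  (* [F] is the global extension of [f]: its slope at [x] is the slope of [f] at [cl x], and
     clamping keeps the side of the kink. *)
  set (F := fun x => g (I x) nu sL sR 0).
  assert (HFL : forall x, x <= 0 -> F x = nu + sL * I x)
    by (intros x Hx; apply g_nonpos, HIsgn, Hx).
  assert (HFR : forall x, 0 <= x -> F x = nu + sR * I x)
    by (intros x Hx; apply g_nonneg, HIsgn, Hx).
  (* Each piece of [f] is recovered from its value [nu] at the kink and its derivative. *)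
  assert (Hsame : forall (fs A : R -> R) s x, fs 0 = nu ->
    (forall z, Rmin 0 x <= z <= Rmax 0 x ->
      is_derive fs z (A z) /\ s * exp (u z) = A z) ->
    fs x = nu + s * I x).
  { intros fs A s x Hfs HA.
    assert (E : fs x - (nu + s * I x) = fs 0 - (nu + s * I 0)).
    { apply (null_derivative (fun x => fs x - (nu + s * I x))). intros z Hz.
      destruct (HA z Hz) as [H1 H2].
      pose proof (is_derive_minus _ _ _ _ _ H1 (HIs s z)) as D.
      rewrite H2 in D. replace 0 with (minus (A z) (A z)); [exact D|].
      apply (minus_eq_zero (G := R_AbelianGroup)). }
    rewrite I0, Hfs in E. lra. }
  assert (HfF : forall x, -p <= x <= p -> f x = F x).
  { intros x Hx. destruct (Hf x Hx) as [H1 H2]. destruct (Rle_dec x 0) as [H|H].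
    - rewrite H1, HFL by exact H. apply Hsame with AL; [exact HL0|].
      intros z. rewrite Rmin_right, Rmax_left by lra. intros Hz. split.
      + apply Hder; lra.
      + rewrite HsL, Hclid by lra. reflexivity.
    - rewrite H2, HFR by lra. apply Hsame with AR; [exact HR0|].
      intros z. rewrite Rmin_left, Rmax_right by lra. intros Hz. split.
      + apply Hder; lra.
      + rewrite HsR, Hclid by lra. reflexivity. }
  assert (HFc : forall x, continuous F x).
  { intros x. apply (continuous_comp I (fun y => g y nu sL sR 0)).
    - apply (ex_derive_continuous (V := R_NormedModule)). exists (exp (u x)). apply HI.
    - apply lipschitz_continuous with (1 := g_lipschitz nu sL sR). }
  assert (HFhyp : hyperbolic_slopes rho (fun _ => True)
    (fun x => sL * exp (u x)) (fun x => sR * exp (u x))).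
  { destruct Hhyp as [Hc|[sigma [Hsigma He]]]; [left|right; exists sigma; split; auto];
      intros x _; split; intros Hx.
    - rewrite HsL by exact Hx. apply (Hc (cl x) (Hcl x)). auto.
    - rewrite HsR by exact Hx. apply (Hc (cl x) (Hcl x)). auto.
    - rewrite HsL by exact Hx. apply (He (cl x) (Hcl x)). auto.
    - rewrite HsR by exact Hx. apply (He (cl x) (Hcl x)). auto. }
  destruct (cocycle_exists F (fun x => nu + sL * I x) (fun x => nu + sR * I x)
    _ _ u rho (2 * K / m) xs Hrho Hk0 ltac:(simpl; rewrite I0; ring) HFL HFR
    (HIs sL) (HIs sR) HFc HFhyp Hu ltac:(rewrite <- HfF; auto) Huxs) as [S [HS HSL]].
  fold L in HSL.
  assert (HL : 0 <= L) by (apply Rdiv_le_0_compat; lra).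
  assert (HSc : forall x, continuous S x)
    by (intros x; now apply lipschitz_continuous with L).
  destruct (conjugacy_of_cocycle I u S nu sL sR I0 HI HSc HS)
    as [h [xi [Hxi [h0 [Hh Hconj]]]]].
  destruct (C1_increasing_diffeo h (fun x => exp (S x - S xi)) (-p) p Hh)
    as [k [Hhom [Hh1 Hk1]]].
  { intros x. apply continuous_comp.
    - apply (continuous_minus (V := R_NormedModule)); [apply HSc|apply continuous_const].
    - apply continuity_pt_filterlim, derivable_continuous_pt, derivable_pt_exp. }
  { intros; apply exp_pos. }
  { lra. }
  (* Here [Rabs xi <= Rabs nu <= p], so [x] and [xi] are at most [2 * p] apart. *)
  assert (Hbound : forall x, -p <= x <= p ->
    exp (- (2 * L * p)) <= exp (S x - S xi) <= exp (2 * L * p)).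
  { intros x Hx.
    assert (Hb : Rabs (S x - S xi) <= 2 * L * p).
    { apply Rle_trans with (1 := HSL x xi).
      assert (Rabs (x - xi) <= 2 * p).
      { assert (Rabs xi <= p) by lra. apply Rabs_le_between in H.
        apply Rabs_le. lra. }
      nra. }
    apply Rabs_le_between in Hb.
    split; apply exp_le_of_le; lra. }
  (* By the mean value theorem from [h 0 = 0], the factor [e] is a value of [h'] on [[-p, p]]. *)
  assert (Hq : forall x, -p <= x <= p -> exists e, h x = e * x /\
    0 < e /\ exp (- (2 * L * p)) <= e <= exp (2 * L * p)).
  { intros x Hx. destruct (increment h _ 0 x Hh) as [c [Hc E]].
    exists (exp (S c - S xi)). split; [rewrite h0 in E; lra|split; [apply exp_pos|]].
    apply Hbound. revert Hc. unfold Rmin, Rmax. destruct Rle_dec; lra. }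
  destruct (Hq p ltac:(lra)) as [ep [Ep [Hep Hep']]].
  destruct (Hq (-p) ltac:(lra)) as [em [Em [Hem Hem']]].
  exists (h (-p)), (h p). split; [|split; [|split]].
  - rewrite Ep, Em. nra.
  - exists h, k. split; [exact Hhom|split; [exact Hh1|split; [exact Hk1|]]].
    intros x Hx _. unfold open_interval in Hx.
    rewrite HfF by lra. apply Hconj.
  - rewrite Em, Rabs_mult, (Rabs_pos_eq em), Rabs_Ropp, (Rabs_pos_eq p) by lra.
    split; apply Rmult_le_compat_r; lra.
  - rewrite Ep, Rabs_mult, (Rabs_pos_eq ep), (Rabs_pos_eq p) by lra.
    split; apply Rmult_le_compat_r; lra.
Qed.

(** * Bounds uniform in the parameter, from smoothness and from the hypotheses on the slopes *)

(** Quantitative form of the smoothness of one piece on a closed square. [A] is the slope; the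
    bounds linear in [mu] concern the kink only, while the Lipschitz bound in [x] is uniform in
    [mu]. *)
Definition C2_slope_bounds (f A : R -> R -> R) (a eps r K : R) : Prop :=
  forall x mu, Rabs x <= r -> Rabs mu <= r ->
    is_derive (fun z => f z mu) x (A x mu) /\
    continuity_2d_pt f x mu /\ continuity_2d_pt A x mu /\
    Rabs (A x mu - a) <= eps /\ Rabs (A 0 mu - a) <= K * Rabs mu /\
    Rabs (f 0 mu) <= K * Rabs mu /\
    (forall y, Rabs y <= r -> Rabs (A x mu - A y mu) <= K * Rabs (x - y)).

Lemma C2_slope_bounds_weaken (f A : R -> R -> R) (a eps r r' K K' : R) :
  r' <= r -> K <= K' ->
  C2_slope_bounds f A a eps r K -> C2_slope_bounds f A a eps r' K'.
Proof.
  intros Hr HK H x mu Hx Hmu.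
  destruct (H x mu) as [H1 [H2 [H3 [H4 [H5 [H6 H7]]]]]]; [lra|lra|].
  pose proof (Rabs_pos mu).
  split; [exact H1|split; [exact H2|split; [exact H3|split; [exact H4|]]]].
  split; [nra|split; [nra|]].
  intros y Hy. pose proof (Rabs_pos (x - y)). pose proof (H7 y ltac:(lra)). nra.
Qed.

Lemma lipschitz_of_derivative_bound (f : R -> R) (r K x y : R) :
  (forall z, Rabs z <= r -> ex_derive f z /\ Rabs (Derive f z) <= K) ->
  Rabs x <= r -> Rabs y <= r -> Rabs (f x - f y) <= K * Rabs (x - y).
Proof.
  intros Hf Hx Hy. apply Rabs_le_between in Hx, Hy.
  assert (Hz : forall z, Rmin y x <= z <= Rmax y x -> Rabs z <= r).
  { intros z. unfold Rmin, Rmax. destruct Rle_dec; intros; apply Rabs_le; lra. }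
  destruct (MVT_gen f y x (Derive f)) as [c [Hc E]].
  - intros z H. apply Derive_correct, Hf, Hz; lra.
  - intros z H. apply continuity_pt_filterlim, (ex_derive_continuous (V := R_NormedModule)).
    now apply Hf, Hz.
  - rewrite E, Rabs_mult. apply Rmult_le_compat_r; [apply Rabs_pos|]. now apply Hf, Hz.
Qed.

Lemma continuity_2d_pt_bounded (f : R -> R -> R) (x y : R) :
  continuity_2d_pt f x y ->
  locally_2d (fun u v => Rabs (f u v) <= Rabs (f x y) + 1) x y.
Proof.
  intros Hf. destruct (Hf (mkposreal 1 Rlt_0_1)) as [d Hd].
  exists d. intros u v Hu Hv. specialize (Hd u v Hu Hv). simpl in Hd.
  pose proof (Rabs_triang_inv (f u v) (f x y)). lra.
Qed.

(** The derivatives of [A] in [x] and [mu] and of [f] in [mu] are continuous at the origin, hence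
    bounded near it; the mean value theorem turns these bounds into the Lipschitz estimates. *)
Lemma C2_slope_bounds_exist (D : R -> R -> Prop) (f : R -> R -> R) (a eps : R) :
  Ck_on_nbhd 2 D f -> D 0 0 -> f 0 0 = 0 -> is_derive (fun x => f x 0) 0 a ->
  0 < eps ->
  exists r K, 0 < r /\
    C2_slope_bounds f (fun x mu => Derive (fun z => f z mu) x) a eps r K.
Proof.
  intros [W [HWo [HDW HW]]] HD f0 Ha Heps.
  set (A := fun x mu => Derive (fun z => f z mu) x).
  set (Ax := fun x mu => Derive (fun z => A z mu) x).
  set (Am := fun x mu => Derive (fun z => A x z) mu).
  set (fm := fun x mu => Derive (fun z => f x z) mu).
  assert (Hdiff : forall x mu, W x mu ->
    continuity_2d_pt f x mu /\ ex_derive (fun z => f z mu) x /\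
    ex_derive (fun z => f x z) mu /\ continuity_2d_pt A x mu /\
    ex_derive (fun z => A z mu) x /\ ex_derive (fun z => A x z) mu /\
    continuity_2d_pt Ax x mu /\ continuity_2d_pt Am x mu /\
    continuity_2d_pt fm x mu).
  { intros x mu Hx.
    destruct (HW x mu Hx) as [H1 [H2 [H3 [[H4 [H5 [H6 [[H7 _] [H8 _]]]]] [H9 _]]]]].
    repeat split; assumption. }
  assert (A0 : A 0 0 = a) by apply is_derive_unique, Ha.
  pose proof (HWo 0 0 (HDW 0 0 HD)) as Hloc.
  destruct (Hdiff 0 0 (HDW 0 0 HD)) as [_ [_ [_ [HAc [_ [_ [HAx [HAm Hfm]]]]]]]].
  pose proof (locally_2d_and _ _ _ _ Hloc (locally_2d_and _ _ _ _ (HAc (mkposreal eps Heps))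
    (locally_2d_and _ _ _ _ (continuity_2d_pt_bounded _ _ _ HAx)
    (locally_2d_and _ _ _ _ (continuity_2d_pt_bounded _ _ _ HAm)
      (continuity_2d_pt_bounded _ _ _ Hfm))))) as [d Hd].
  simpl in Hd. pose proof (cond_pos d) as Hdpos.
  set (K := (Rabs (Ax 0 0) + 1) + (Rabs (Am 0 0) + 1) + (Rabs (fm 0 0) + 1)).
  pose proof (Rabs_pos (Ax 0 0)). pose proof (Rabs_pos (Am 0 0)).
  pose proof (Rabs_pos (fm 0 0)).
  assert (Hall : forall x mu, Rabs x <= d / 2 -> Rabs mu <= d / 2 -> W x mu /\
    Rabs (A x mu - a) <= eps /\ Rabs (Ax x mu) <= K /\ Rabs (Am x mu) <= K /\
    Rabs (fm x mu) <= K).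
  { intros x mu Hx Hmu.
    destruct (Hd x mu) as [H3 [H4 [H5 [H6 H7]]]];
      [rewrite Rminus_0_r; lra|rewrite Rminus_0_r; lra|].
    rewrite A0 in H4. unfold K. repeat split; [assumption|lra..]. }
  assert (Hzero : Rabs 0 <= d / 2) by (rewrite Rabs_R0; lra).
  (* Halving [d] puts the closed square inside the open one on which the bounds hold. *)
  exists (d / 2), K. split; [lra|]. intros x mu Hx Hmu.
  destruct (Hall x mu Hx Hmu) as [HWx [HAe _]].
  destruct (Hdiff x mu HWx) as [H3 [H4 [_ [H5 _]]]].
  split; [now apply Derive_correct|split; [exact H3|split; [exact H5|split; [exact HAe|]]]].
  split; [|split].
  - pose proof (lipschitz_of_derivative_bound (A 0) (d / 2) K mu 0) as HL.
    rewrite A0, Rminus_0_r in HL. apply HL; auto.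
    intros z Hz. destruct (Hall 0 z Hzero Hz) as [Hw [_ [_ [Hb _]]]]. split; [|exact Hb].
    apply (Hdiff _ _ Hw).
  - pose proof (lipschitz_of_derivative_bound (f 0) (d / 2) K mu 0) as HL.
    rewrite f0, !Rminus_0_r in HL. apply HL; auto.
    intros z Hz. destruct (Hall 0 z Hzero Hz) as [Hw [_ [_ [_ Hb]]]]. split; [|exact Hb].
    apply (Hdiff _ _ Hw).
  - intros y Hy.
    apply (lipschitz_of_derivative_bound (fun z => A z mu) (d / 2)); auto.
    intros z Hz. destruct (Hall z mu Hz Hmu) as [Hw [_ [Hb _]]]. split; [|exact Hb].
    apply (Hdiff _ _ Hw).
Qed.

Lemma open_interval_nbhd (S : R -> Prop) (x0 : R) : is_open_interval S -> S x0 ->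
  exists r, 0 < r /\ forall x, Rabs (x - x0) <= r -> S x.
Proof.
  intros [a [b H]] H0. apply H in H0.
  destruct (locally_interval S x0 a b) as [d Hd]; try tauto.
  - intros y Hya Hyb. apply H. tauto.
  - pose proof (cond_pos d). exists (d / 2). split; [lra|]. intros x Hx. apply Hd.
    change (Rabs (x - x0) < d). lra.
Qed.

Lemma is_open_interval_bounded (a b : R) : is_open_interval (open_interval a b).
Proof. exists a, b. intros x. reflexivity. Qed.

(** The sign conditions put both slopes in [(-1, 1)], both above [1], or both below [-1]. With [d]
    half their least distance to [-1], [0] and [1], slopes within [d] of them keep a margin [d].
    This gives [rho = 1 - d] for a contraction and [/ (1 + d)] for an expansion; [s] is the common
    sign of slope minus [1]. *)
Lemma slope_margins (aL aR : R) :
  0 < (aL - 1) * (aR - 1) -> 0 < (aL + 1) * (aR + 1) -> aL <> 0 -> aR <> 0 ->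
  exists d rho s, 0 < d /\ 0 < rho < 1 /\ (s = 1 \/ s = -1) /\
    (forall b a, a = aL \/ a = aR -> Rabs (b - a) <= d ->
      d <= s * (b - 1) /\ d <= Rabs b /\ 0 < a * b) /\
    (forall (D : R -> Prop) (AL AR : R -> R),
      (forall x, D x -> Rabs (AL x - aL) <= d /\ Rabs (AR x - aR) <= d) ->
      hyperbolic_slopes rho D AL AR).
Proof.
  intros Hm Hp HL HR.
  assert (Hd : exists d, 0 < d /\ forall a, a = aL \/ a = aR ->
    2 * d <= Rabs a /\ 2 * d <= Rabs (a - 1) /\ 2 * d <= Rabs (a + 1)).
  { set (mn := fun a => Rmin (Rabs a) (Rmin (Rabs (a - 1)) (Rabs (a + 1)))).
    assert (Hmn : forall a, a = aL \/ a = aR -> 0 < mn a).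
    { intros a Ha. unfold mn. repeat apply Rmin_glb_lt; apply Rabs_pos_lt;
        destruct Ha as [-> | ->]; try assumption; intros E; rewrite E in *; lra. }
    exists (Rmin (mn aL) (mn aR) / 2). split.
    - pose proof (Rmin_glb_lt _ _ _ (Hmn aL (or_introl eq_refl)) (Hmn aR (or_intror eq_refl))).
      lra.
    - intros a Ha.
      assert (Hle : 2 * (Rmin (mn aL) (mn aR) / 2) <= mn a).
      { destruct Ha as [-> | ->];
          [pose proof (Rmin_l (mn aL) (mn aR))|pose proof (Rmin_r (mn aL) (mn aR))]; lra. }
      unfold mn at 3 in Hle.
      pose proof (Rmin_l (Rabs a) (Rmin (Rabs (a - 1)) (Rabs (a + 1)))).
      pose proof (Rmin_r (Rabs a) (Rmin (Rabs (a - 1)) (Rabs (a + 1)))).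
      pose proof (Rmin_l (Rabs (a - 1)) (Rabs (a + 1))).
      pose proof (Rmin_r (Rabs (a - 1)) (Rabs (a + 1))). lra. }
  destruct Hd as [d [Hd Hda]].
  assert (Hnz : forall b a, a = aL \/ a = aR -> Rabs (b - a) <= d ->
    d <= Rabs b /\ 0 < a * b).
  { intros b a Ha Hb. destruct (Hda a Ha) as [H1 _]. revert H1 Hb.
    unfold Rabs. repeat destruct Rcase_abs; intros; split; nra. }
  assert (Hcase : (forall a, a = aL \/ a = aR -> -1 + 2 * d <= a <= 1 - 2 * d) \/
    (forall a, a = aL \/ a = aR -> 1 + 2 * d <= a) \/
    (forall a, a = aL \/ a = aR -> a <= -1 - 2 * d)).
  { destruct (Hda aL (or_introl eq_refl)) as [_ [L1 L2]].
    destruct (Hda aR (or_intror eq_refl)) as [_ [R1 R2]].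
    unfold Rabs in *.
    destruct (Rcase_abs (aL - 1)), (Rcase_abs (aR - 1)); try (exfalso; nra);
      destruct (Rcase_abs (aL + 1)), (Rcase_abs (aR + 1)); try (exfalso; nra).
    - right; right; intros a [-> | ->]; lra.
    - left; intros a [-> | ->]; lra.
    - right; left; intros a [-> | ->]; lra. }
  destruct Hcase as [H|[H|H]].
  - exists d, (1 - d), (-1).
    pose proof (H aL (or_introl eq_refl)). pose proof (H aR (or_intror eq_refl)).
    split; [exact Hd|split; [lra|split; [now right|split]]].
    + intros b a Ha Hb. split; [|now apply Hnz].
      specialize (H a Ha). apply Rabs_le_between in Hb. lra.
    + intros D AL AR HD. left. intros x Hx. destruct (HD x Hx) as [H2 H3].
      apply Rabs_le_between in H2, H3. split; intros _; apply Rabs_le; lra.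
  - exists d, (/ (1 + d)), 1.
    pose proof (H aL (or_introl eq_refl)). pose proof (H aR (or_intror eq_refl)).
    split; [exact Hd|split; [|split; [now left|split]]].
    + split; [apply Rinv_0_lt_compat; lra|].
      rewrite <- Rinv_1. apply Rinv_lt_contravar; lra.
    + intros b a Ha Hb. split; [|now apply Hnz].
      specialize (H a Ha). apply Rabs_le_between in Hb. lra.
    + intros D AL AR HD. right. exists 1. split; [now left|].
      intros x Hx. destruct (HD x Hx) as [H2 H3]. rewrite Rinv_inv.
      apply Rabs_le_between in H2, H3. lra.
  - exists d, (/ (1 + d)), (-1).
    pose proof (H aL (or_introl eq_refl)). pose proof (H aR (or_intror eq_refl)).
    split; [exact Hd|split; [|split; [now right|split]]].
    + split; [apply Rinv_0_lt_compat; lra|].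
      rewrite <- Rinv_1. apply Rinv_lt_contravar; lra.
    + intros b a Ha Hb. split; [|now apply Hnz].
      specialize (H a Ha). apply Rabs_le_between in Hb. lra.
    + intros D AL AR HD. right. exists (-1). split; [now right|].
      intros x Hx. destruct (HD x Hx) as [H2 H3]. rewrite Rinv_inv.
      apply Rabs_le_between in H2, H3. lra.
Qed.

(** * The branch of fixed points *)

Lemma continuous_2d_comp (A : R -> R -> R) (X : R -> R) (mu : R) :
  continuity_2d_pt A (X mu) mu -> continuous X mu -> continuous (fun mu => A (X mu) mu) mu.
Proof.
  intros HA HX. apply (continuous_comp_2 X (fun mu => mu) A); [exact HX|apply continuous_id|].
  now apply continuity_2d_pt_filterlim.
Qed.

Lemma Rmin_0_continuous (x : R) : continuous (fun x => Rmin x 0) x.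
Proof.
  apply lipschitz_continuous with 1. intros a b. rewrite Rmult_1_l.
  unfold Rmin, Rabs. repeat destruct Rle_dec; repeat destruct Rcase_abs; lra.
Qed.

Lemma Rmax_0_continuous (x : R) : continuous (fun x => Rmax x 0) x.
Proof.
  apply lipschitz_continuous with 1. intros a b. rewrite Rmult_1_l.
  unfold Rmax, Rabs. repeat destruct Rle_dec; repeat destruct Rcase_abs; lra.
Qed.

(** The function [s * (f x mu - x)] grows in [x] at rate at least [d], also across the kink. A sign
    change gives the fixed point, and the growth rate gives both its size, from the value at [0],
    and its continuity in [mu]. *)
Lemma fixed_point_branch (f fL fR AL AR : R -> R -> R) (aL aR d r K s : R) :
  0 < d -> 0 < r -> s = 1 \/ s = -1 ->
  C2_slope_bounds fL AL aL d r K -> C2_slope_bounds fR AR aR d r K ->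
  (forall b a, a = aL \/ a = aR -> Rabs (b - a) <= d -> d <= s * (b - 1)) ->
  (forall x mu, Rabs x <= r -> Rabs mu <= r ->
    (x <= 0 -> f x mu = fL x mu) /\ (0 <= x -> f x mu = fR x mu)) ->
  exists (mu0 : R) (xs : R -> R), 0 < mu0 <= r /\ forall mu, Rabs mu < mu0 ->
    Rabs (xs mu) <= r /\ f (xs mu) mu = xs mu /\
    d * Rabs (xs mu) <= K * Rabs mu /\ continuous xs mu.
Proof.
  intros Hd Hr Hs HL HR Hdb Hf.
  assert (Hs2 : s * s = 1) by (destruct Hs as [-> | ->]; ring).
  assert (Hsabs : forall x, Rabs (s * x) = Rabs x).
  { intros x. rewrite Rabs_mult.
    destruct Hs as [-> | ->]; [rewrite Rabs_R1|rewrite Rabs_m1]; ring. }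
  assert (H0r : Rabs 0 <= r) by (rewrite Rabs_R0; lra).
  assert (Hin : forall x, -r <= x <= r -> Rabs x <= r) by (intros; now apply Rabs_le).
  assert (Hkink : forall mu, Rabs mu <= r -> fL 0 mu = fR 0 mu).
  { intros mu Hmu. destruct (Hf 0 mu H0r Hmu) as [<- <-]; lra. }
  assert (Hexp : forall mu x y, Rabs mu <= r -> -r <= x -> y <= r -> x <= y ->
    d * (y - x) <= s * (f y mu - y) - s * (f x mu - x)).
  { intros mu x y Hmu Hx Hy Hxy.
    apply (piecewise_slope_lower_bound (fun z => s * (f z mu - z))
      (fun z => s * (fL z mu - z)) (fun z => s * (fR z mu - z))
      (fun z => s * (AL z mu - 1)) (fun z => s * (AR z mu - 1))); [exact Hxy| | |].
    - simpl. now rewrite Hkink.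
    - intros z Hz Hz0.
      destruct (HL z mu (Hin z ltac:(lra)) Hmu) as [D [_ [_ [HA _]]]].
      split; [|split].
      + now rewrite (proj1 (Hf z mu (Hin z ltac:(lra)) Hmu)).
      + apply is_derive_scal, (is_derive_minus (V := R_NormedModule)); [exact D|].
        apply (is_derive_id (K := R_AbsRing)).
      + now apply (Hdb _ aL (or_introl eq_refl)).
    - intros z Hz Hz0.
      destruct (HR z mu (Hin z ltac:(lra)) Hmu) as [D [_ [_ [HA _]]]].
      split; [|split].
      + now rewrite (proj2 (Hf z mu (Hin z ltac:(lra)) Hmu)).
      + apply is_derive_scal, (is_derive_minus (V := R_NormedModule)); [exact D|].
        apply (is_derive_id (K := R_AbsRing)).
      + now apply (Hdb _ aR (or_intror eq_refl)). }
  assert (Hexpabs : forall mu x y, Rabs mu <= r -> Rabs x <= r -> Rabs y <= r ->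
    d * Rabs (x - y) <= Rabs ((f x mu - x) - (f y mu - y))).
  { intros mu x y Hmu Hx Hy.
    rewrite <- (Hsabs (f x mu - x - (f y mu - y))), Rmult_minus_distr_l.
    apply Rabs_le_between in Hx, Hy. destruct (Rle_dec x y).
    - rewrite (Rabs_minus_sym x), (Rabs_pos_eq (y - x)), Rabs_minus_sym by lra.
      apply Rle_trans with (2 := Rle_abs _). apply Hexp; lra.
    - rewrite (Rabs_pos_eq (x - y)) by lra.
      apply Rle_trans with (2 := Rle_abs _). apply Hexp; lra. }
  assert (HK1 : 0 < Rabs K + 1) by (pose proof (Rabs_pos K); lra).
  (* This makes [K * Rabs mu < d * r]: the value at [0] is too small to prevent a sign change on
     [[-r, r]]. *)
  set (mu0 := Rmin r (d * r / (Rabs K + 1))).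
  assert (Hmu0 : 0 < mu0 <= r).
  { split; [|apply Rmin_l]. apply Rmin_glb_lt; [lra|]. apply Rdiv_lt_0_compat; nra. }
  assert (Hmur : forall mu, Rabs mu < mu0 -> Rabs mu <= r) by (intros; lra).
  assert (Hf0 : forall mu, Rabs mu < mu0 -> Rabs (f 0 mu) <= K * Rabs mu).
  { intros mu Hmu. rewrite (proj1 (Hf 0 mu H0r (Hmur mu Hmu))) by lra.
    apply (HL 0 mu H0r (Hmur mu Hmu)). }
  assert (Hsmall : forall mu, Rabs mu < mu0 -> K * Rabs mu < d * r).
  { intros mu Hmu. pose proof (Rabs_pos mu).
    assert (mu0 * (Rabs K + 1) <= d * r).
    { apply Rle_trans with (d * r / (Rabs K + 1) * (Rabs K + 1)).
      - apply Rmult_le_compat_r; [lra|apply Rmin_r].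
      - apply Req_le. field. lra. }
    pose proof (Rle_abs K). nra. }
  assert (Hex : forall mu, exists x, Rabs mu < mu0 -> Rabs x <= r /\ f x mu = x).
  { intros mu. destruct (Rlt_dec (Rabs mu) mu0) as [Hmu|Hmu]; [|exists 0; lra].
    specialize (Hmur mu Hmu). specialize (Hf0 mu Hmu). specialize (Hsmall mu Hmu).
    (* The formula by pieces agrees with [s * (f z mu - z)] on [[-r, r]] and is continuous from both
       sides even at the end points, where [f] is controlled from inside only. *)
    set (q := fun z => s * (fL (Rmin z 0) mu + fR (Rmax z 0) mu - fL 0 mu - z)).
    assert (Hq : forall z, -r <= z <= r -> q z = s * (f z mu - z)).
    { intros z Hz. unfold q. destruct (Hf z mu (Hin z Hz) Hmur) as [H1 H2].
      destruct (Rle_dec z 0).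
      - rewrite Rmin_left, Rmax_right, H1, <- Hkink by lra. ring.
      - rewrite Rmin_right, Rmax_left, H2 by lra. ring. }
    assert (Hb : Rabs (s * (f 0 mu - 0)) < d * r)
      by (rewrite Rminus_0_r, Hsabs; lra).
    apply Rabs_lt_between in Hb.
    pose proof (Hexp mu 0 r Hmur ltac:(lra) ltac:(lra) ltac:(lra)).
    pose proof (Hexp mu (-r) 0 Hmur ltac:(lra) ltac:(lra) ltac:(lra)).
    destruct (IVT_interv q (-r) r) as [x [Hx Hqx]].
    - intros z Hz. apply continuity_pt_filterlim. change (continuous q z).
      apply (continuous_scal_r (V := R_NormedModule)).
      apply (continuous_minus (V := R_NormedModule)); [|apply continuous_id].
      apply (continuous_minus (V := R_NormedModule)); [|apply continuous_const].
      apply (continuous_plus (V := R_NormedModule)).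
      + apply (continuous_comp (fun z => Rmin z 0) (fun z => fL z mu));
          [apply Rmin_0_continuous|].
        apply (ex_derive_continuous (V := R_NormedModule)). exists (AL (Rmin z 0) mu).
        apply HL; [|exact Hmur]. apply Hin. unfold Rmin; destruct Rle_dec; lra.
      + apply (continuous_comp (fun z => Rmax z 0) (fun z => fR z mu));
          [apply Rmax_0_continuous|].
        apply (ex_derive_continuous (V := R_NormedModule)). exists (AR (Rmax z 0) mu).
        apply HR; [|exact Hmur]. apply Hin. unfold Rmax; destruct Rle_dec; lra.
    - lra.
    - rewrite Hq by lra. lra.
    - rewrite Hq by lra. lra.
    - exists x. intros _. split; [now apply Hin|].
      rewrite Hq in Hqx by exact Hx.
      assert (s * (s * (f x mu - x)) = 0) by (rewrite Hqx; ring).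
      rewrite <- Rmult_assoc, Hs2 in H1. lra. }
  set (xs := fun mu => proj1_sig (constructive_indefinite_description _ (Hex mu))).
  assert (Hxs : forall mu, Rabs mu < mu0 -> Rabs (xs mu) <= r /\ f (xs mu) mu = xs mu)
    by (intros mu; unfold xs; now destruct (constructive_indefinite_description _ _)).
  clearbody xs. exists mu0, xs. split; [exact Hmu0|]. intros mu Hmu.
  destruct (Hxs mu Hmu) as [Hx1 Hx2].
  split; [exact Hx1|split; [exact Hx2|split]].
  - pose proof (Hexpabs mu (xs mu) 0 (Hmur mu Hmu) Hx1 H0r) as H.
    rewrite Hx2, Rminus_diag, !Rminus_0_r, Rminus_0_l, Rabs_Ropp in H.
    apply Rle_trans with (1 := H). now apply Hf0.
  (* The growth rate bounds [d * Rabs (xs nu - xs mu)] by the change of [f (xs mu)] between [mu] and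
     [nu], so continuity in the parameter at the fixed point [xs mu] suffices. *)
  - assert (Hfc : exists fs : R -> R, continuous fs mu /\
      forall nu, Rabs nu <= r -> f (xs mu) nu = fs nu).
    { destruct (Rle_dec (xs mu) 0) as [Hneg|Hpos].
      - exists (fun nu => fL (xs mu) nu). split.
        + apply (continuous_2d_comp fL (fun _ => xs mu)); [|apply continuous_const].
          apply (HL _ _ Hx1 (Hmur mu Hmu)).
        + intros nu Hnu. now apply (Hf (xs mu) nu Hx1 Hnu).
      - exists (fun nu => fR (xs mu) nu). split.
        + apply (continuous_2d_comp fR (fun _ => xs mu)); [|apply continuous_const].
          apply (HR _ _ Hx1 (Hmur mu Hmu)).
        + intros nu Hnu. apply (Hf (xs mu) nu Hx1 Hnu). lra. }
    destruct Hfc as [fs [Hfc Hfs]].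
    apply filterlim_locally. intros eps.
    assert (Heps : 0 < d * eps) by (apply Rmult_lt_0_compat; [lra|apply cond_pos]).
    pose proof (proj1 (filterlim_locally fs (fs mu)) Hfc (mkposreal _ Heps)) as Hn.
    assert (Hn2 : locally mu (fun nu => Rabs nu < mu0)).
    { apply Rabs_lt_between in Hmu.
      apply (locally_interval _ mu (- mu0) mu0); simpl; try lra.
      intros nu H1 H2. apply Rabs_def1; lra. }
    apply filter_imp with (2 := filter_and _ _ Hn Hn2). intros nu [H1 H2].
    change (Rabs (fs nu - fs mu) < d * eps) in H1.
    change (Rabs (xs nu - xs mu) < eps).
    destruct (Hxs nu H2) as [Hy1 Hy2].
    pose proof (Hexpabs nu (xs nu) (xs mu) (Hmur nu H2) Hy1 Hx1) as H.
    rewrite Hy2, Rminus_diag, Rminus_0_l, Rabs_Ropp in H.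
    rewrite (Hfs mu (Hmur mu Hmu)) in Hx2.
    rewrite (Hfs nu (Hmur nu H2)) in H. rewrite Hx2 in H1.
    apply Rmult_lt_reg_l with d; lra.
Qed.

(** * Slopes of the normal form and choice of the neighbourhoods *)

Lemma exp_minus_1_bound (x b : R) : Rabs x <= b -> Rabs (exp x - 1) <= exp b * Rabs x.
Proof.
  intros Hx. destruct (increment exp exp 0 x is_derive_exp) as [c [Hc E]].
  rewrite exp_0, Rminus_0_r in E. rewrite E, Rabs_mult, Rabs_pos_eq
    by apply Rlt_le, exp_pos.
  apply Rmult_le_compat_r; [apply Rabs_pos|]. apply exp_le_of_le.
  apply Rabs_le_between in Hx. revert Hc. unfold Rmin, Rmax. destruct Rle_dec; lra.
Qed.

(** Split [A * exp E - a] as [A * (exp E - 1) + (A - a)]: both parts are linear in [mu] because [A]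
    stays bounded. *)
Lemma perturbed_slope_bigO (A E : R -> R) (a K C mu0 : R) : 0 < mu0 ->
  (forall mu, Rabs mu < mu0 -> Rabs (A mu - a) <= K * Rabs mu) ->
  (forall mu, Rabs mu < mu0 -> Rabs (E mu) <= C * Rabs mu) ->
  is_bigO (locally 0) (fun mu => A mu * exp (E mu) - a) (fun mu => mu).
Proof.
  intros Hmu0 HA HE.
  exists ((Rabs a + Rabs K * mu0) * (exp (Rabs C * mu0) * Rabs C) + Rabs K).
  exists (mkposreal _ Hmu0). intros mu Hmu. change (Rabs (mu - 0) < mu0) in Hmu.
  rewrite Rminus_0_r in Hmu. specialize (HA mu Hmu). specialize (HE mu Hmu).
  pose proof (Rabs_pos mu). pose proof (Rle_abs C). pose proof (Rle_abs K).
  pose proof (Rabs_pos C). pose proof (Rabs_pos K).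
  assert (HE' : Rabs (E mu) <= Rabs C * Rabs mu) by nra.
  assert (HA' : Rabs (A mu - a) <= Rabs K * Rabs mu) by nra.
  assert (H4 : Rabs (exp (E mu) - 1) <= exp (Rabs C * mu0) * (Rabs C * Rabs mu)).
  { apply Rle_trans with (exp (Rabs C * mu0) * Rabs (E mu)).
    - apply exp_minus_1_bound. nra.
    - apply Rmult_le_compat_l; [apply Rlt_le, exp_pos|exact HE']. }
  assert (H5 : Rabs (A mu) <= Rabs a + Rabs K * mu0).
  { pose proof (Rabs_triang_inv (A mu) a). nra. }
  replace (A mu * exp (E mu) - a) with (A mu * (exp (E mu) - 1) + (A mu - a)) by ring.
  apply Rle_trans with (1 := Rabs_triang _ _). rewrite Rabs_mult.
  pose proof (Rmult_le_compat _ _ _ _ (Rabs_pos _) (Rabs_pos _) H5 H4). lra.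
Qed.

Theorem theorem2p1
  (Omega J : R -> Prop)
  (hOmega : is_open_interval Omega) (hOmega0 : Omega 0)
  (hJ : is_open_interval J) (hJ0 : J 0)
  (f fL fR : R -> R -> R)
  (hf : piecewise_Ck 2 Omega J fL fR f)
  (hcont : forall mu : R, J mu -> fL 0 mu = fR 0 mu)
  (hL0 : fL 0 0 = 0) (hR0 : fR 0 0 = 0)
  (aL aR beta : R)
  (haL : is_derive (fun x => fL x 0) 0 aL)
  (haR : is_derive (fun x => fR x 0) 0 aR)
  (hbetaL : is_derive (fun mu => fL 0 mu) 0 beta)
  (hbetaR : is_derive (fun mu => fR 0 mu) 0 beta)
  (hbeta : 0 < beta)
  (hm1 : 0 < (aL - 1) * (aR - 1))
  (hp1 : 0 < (aL + 1) * (aR + 1))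
  (hL : aL <> 0) (hR : aR <> 0) :
  let nu := fun mu : R => f 0 mu in
  exists (mu0 : R) (sL sR : R -> R) (N : R -> Prop) (M : R -> R -> Prop),
    0 < mu0 /\
    (forall mu, - mu0 < mu < mu0 -> J mu) /\
    (forall mu, - mu0 < mu < mu0 -> continuous sL mu /\ continuous sR mu) /\
    is_bigO (locally 0) (fun mu => sL mu - aL) (fun mu => mu) /\
    is_bigO (locally 0) (fun mu => sR mu - aR) (fun mu => mu) /\
    is_open_interval N /\ N 0 /\ (forall x, N x -> Omega x) /\
    (forall mu, - mu0 < mu < mu0 ->
       is_open_interval (M mu) /\ M mu 0 /\
       differentiably_conjugate
         (fun x => f x mu) N
         (fun y => g y (nu mu) (sL mu) (sR mu) 0) (M mu)) /\
    (forall delta : R, 0 < delta ->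
       exists (mu1 p : R) (qm qp : R -> R),
         0 < mu1 <= mu0 /\
         0 < p /\ (forall x, open_interval (- p) p x -> Omega x) /\
         (forall mu, - mu1 < mu < mu1 ->
            qm mu < 0 < qp mu /\
            differentiably_conjugate
              (fun x => f x mu) (open_interval (- p) p)
              (fun y => g y (nu mu) (sL mu) (sR mu) 0)
              (open_interval (qm mu) (qp mu)) /\
            (1 - delta) * p < Rabs (qm mu) < (1 + delta) * p /\
            (1 - delta) * p < Rabs (qp mu) < (1 + delta) * p)).
Proof.
  intros nu. destruct hf as [HCL [HCR [HfL HfR]]].
  destruct (slope_margins aL aR hm1 hp1 hL hR)
    as [d [rho [s [Hd [Hrho [Hs [Hmargin Hhyp]]]]]]].
  destruct (open_interval_nbhd Omega 0 hOmega hOmega0) as [rO [HrO HO]].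
  destruct (open_interval_nbhd J 0 hJ hJ0) as [rJ [HrJ HJ]].
  destruct (C2_slope_bounds_exist _ fL aL d HCL) as [rL [KL [HrL BL]]]; auto.
  { repeat split; auto. lra. }
  destruct (C2_slope_bounds_exist _ fR aR d HCR) as [rR [KR [HrR BR]]]; auto.
  { repeat split; auto. lra. }
  set (AL := fun x mu => Derive (fun z => fL z mu) x) in BL.
  set (AR := fun x mu => Derive (fun z => fR z mu) x) in BR.
  clearbody AL AR.
  assert (Hr : exists r, 0 < r /\ r <= rO /\ r <= rJ /\ r <= rL /\ r <= rR).
  { exists (Rmin (Rmin rO rJ) (Rmin rL rR)). split.
    - repeat apply Rmin_glb_lt; assumption.
    - pose proof (Rmin_l (Rmin rO rJ) (Rmin rL rR)).
      pose proof (Rmin_r (Rmin rO rJ) (Rmin rL rR)).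
      pose proof (Rmin_l rO rJ). pose proof (Rmin_r rO rJ).
      pose proof (Rmin_l rL rR). pose proof (Rmin_r rL rR). lra. }
  destruct Hr as [r [Hr [HrO' [HrJ' [HrL' HrR']]]]].
  set (K := Rmax 0 (Rmax KL KR)).
  assert (HK : 0 <= K) by apply Rmax_l.
  assert (HKL : KL <= K)
    by (apply Rle_trans with (2 := Rmax_r _ _); apply Rmax_l).
  assert (HKR : KR <= K)
    by (apply Rle_trans with (2 := Rmax_r _ _); apply Rmax_r).
  apply (C2_slope_bounds_weaken _ _ _ _ _ r _ K HrL' HKL) in BL.
  apply (C2_slope_bounds_weaken _ _ _ _ _ r _ K HrR' HKR) in BR.
  clearbody K. clear KL KR HKL HKR rL rR HrL HrR HrL' HrR' HCL HCR.
  assert (HO' : forall x, Rabs x <= r -> Omega x)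
    by (intros x Hx; apply HO; rewrite Rminus_0_r; lra).
  assert (HJ' : forall mu, Rabs mu <= r -> J mu)
    by (intros mu Hmu; apply HJ; rewrite Rminus_0_r; lra).
  assert (Hf : forall x mu, Rabs x <= r -> Rabs mu <= r ->
    (x <= 0 -> f x mu = fL x mu) /\ (0 <= x -> f x mu = fR x mu)) by auto.
  destruct (fixed_point_branch f fL fR AL AR aL aR d r K s Hd Hr Hs BL BR)
    as [mu0 [xs [Hmu0 Hxs]]]; auto.
  { intros b a Ha Hb. now apply (Hmargin b a). }
  assert (H0r : Rabs 0 <= r) by (rewrite Rabs_R0; lra).
  (* [E] normalises the slope quotient at the fixed point. It does not involve [p], so the same [sL]
     and [sR] serve every [delta]. *)
  set (E := fun mu => log_slope (fun z => AL z mu) (fun z => AR z mu) (xs mu)).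
  set (sL := fun mu => AL 0 mu * exp (E mu)).
  set (sR := fun mu => AR 0 mu * exp (E mu)).
  assert (HAL : forall x mu, Rabs x <= r -> Rabs mu <= r ->
    d <= Rabs (AL x mu) /\ 0 < aL * AL x mu).
  { intros x mu Hx Hmu. apply (Hmargin (AL x mu) aL); [now left|].
    apply (BL x mu Hx Hmu). }
  assert (HAR : forall x mu, Rabs x <= r -> Rabs mu <= r ->
    d <= Rabs (AR x mu) /\ 0 < aR * AR x mu).
  { intros x mu Hx Hmu. apply (Hmargin (AR x mu) aR); [now right|].
    apply (BR x mu Hx Hmu). }
  assert (HAlip : forall mu x y, Rabs mu <= r -> -r <= x <= r -> -r <= y <= r ->
    Rabs (AL x mu - AL y mu) <= K * Rabs (x - y) /\
    Rabs (AR x mu - AR y mu) <= K * Rabs (x - y)).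
  { intros mu x y Hmu Hx Hy. apply Rabs_le in Hx, Hy.
    split; [apply (BL x mu Hx Hmu)|apply (BR x mu Hx Hmu)]; exact Hy. }
  (* [log_slope] vanishes at [0] with Lipschitz constant [2 * K / d], and the fixed point is within
     [K / d * Rabs mu] of [0]. *)
  assert (HE : forall mu, Rabs mu < mu0 ->
    Rabs (E mu) <= 2 * K / d * (K / d) * Rabs mu).
  { intros mu Hmu. destruct (Hxs mu Hmu) as [H1 [_ [H2 _]]].
    assert (Hmur : Rabs mu <= r) by lra.
    pose proof (log_slope_lipschitz (fun z => AL z mu) (fun z => AR z mu)
      d K r (xs mu) 0 Hd HK) as H.
    assert (E0 : log_slope (fun z => AL z mu) (fun z => AR z mu) 0 = 0).
    { unfold log_slope. rewrite Rmin_left, Rmax_left by lra. ring. }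
    rewrite E0, !Rminus_0_r in H.
    apply Rle_trans with (2 * K / d * Rabs (xs mu)).
    - apply H.
      + intros x Hx. apply Rabs_le in Hx. split; [now apply HAL|now apply HAR].
      + intros x y Hx Hy. now apply HAlip.
      + now apply Rabs_le_between.
      + lra.
    - rewrite Rmult_assoc. apply Rmult_le_compat_l; [apply Rdiv_le_0_compat; lra|].
      apply Rmult_le_reg_l with d; [lra|]. apply Rle_trans with (1 := H2).
      apply Req_le. field. lra. }
  assert (Hmu_in : forall mu, Rabs mu < mu0 -> Rabs mu <= r) by (intros; lra).
  assert (HlnA : forall (A : R -> R -> R) (X : R -> R) mu,
    continuity_2d_pt A (X mu) mu -> continuous X mu -> 0 < Rabs (A (X mu) mu) ->
    continuous (fun mu => ln (Rabs (A (X mu) mu))) mu).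
  { intros A X mu HA HX Hpos.
    apply (continuous_comp (fun mu => A (X mu) mu) (fun y => ln (Rabs y))).
    - now apply continuous_2d_comp.
    - apply (continuous_comp Rabs ln); [apply continuous_Rabs|].
      apply continuity_pt_filterlim, derivable_continuous_pt.
      exists (/ Rabs (A (X mu) mu)). now apply derivable_pt_lim_ln. }
  assert (HEc : forall mu, Rabs mu < mu0 -> continuous E mu).
  { intros mu Hmu. specialize (Hmu_in mu Hmu).
    destruct (Hxs mu Hmu) as [H1 [_ [_ H2]]].
    assert (Hmin : Rabs (Rmin (xs mu) 0) <= r).
    { apply Rabs_le_between in H1. apply Rabs_le. unfold Rmin; destruct Rle_dec; lra. }
    assert (Hmax : Rabs (Rmax (xs mu) 0) <= r).
    { apply Rabs_le_between in H1. apply Rabs_le. unfold Rmax; destruct Rle_dec; lra. }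
    assert (HcL : forall X : R -> R, Rabs (X mu) <= r -> continuous X mu ->
      continuous (fun mu => ln (Rabs (AL (X mu) mu))) mu).
    { intros X HXr HX. apply HlnA; [apply (BL _ _ HXr Hmu_in)|exact HX|].
      pose proof (HAL _ _ HXr Hmu_in). lra. }
    assert (HcR : forall X : R -> R, Rabs (X mu) <= r -> continuous X mu ->
      continuous (fun mu => ln (Rabs (AR (X mu) mu))) mu).
    { intros X HXr HX. apply HlnA; [apply (BR _ _ HXr Hmu_in)|exact HX|].
      pose proof (HAR _ _ HXr Hmu_in). lra. }
    apply (continuous_plus (V := R_NormedModule));
      apply (continuous_minus (V := R_NormedModule)).
    - apply (HcL (fun mu => Rmin (xs mu) 0)); [exact Hmin|].
      apply (continuous_comp xs (fun x => Rmin x 0)); [exact H2|apply Rmin_0_continuous].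
    - apply (HcL (fun _ => 0)); [exact H0r|apply continuous_const].
    - apply (HcR (fun mu => Rmax (xs mu) 0)); [exact Hmax|].
      apply (continuous_comp xs (fun x => Rmax x 0)); [exact H2|apply Rmax_0_continuous].
    - apply (HcR (fun _ => 0)); [exact H0r|apply continuous_const]. }
  assert (HeEc : forall mu, Rabs mu < mu0 -> continuous (fun mu => exp (E mu)) mu).
  { intros mu Hmu. apply continuous_comp; [now apply HEc|].
    apply continuity_pt_filterlim, derivable_continuous_pt, derivable_pt_exp. }
  assert (Hsc : forall mu, Rabs mu < mu0 -> continuous sL mu /\ continuous sR mu).
  { intros mu Hmu. split.
    - apply (continuous_mult (K := R_AbsRing)); [|now apply HeEc].
      apply (continuous_2d_comp AL (fun _ => 0)); [|apply continuous_const].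
      apply (BL 0 mu H0r (Hmu_in mu Hmu)).
    - apply (continuous_mult (K := R_AbsRing)); [|now apply HeEc].
      apply (continuous_2d_comp AR (fun _ => 0)); [|apply continuous_const].
      apply (BR 0 mu H0r (Hmu_in mu Hmu)). }
  set (L := 2 * K / d / (1 - rho)).
  assert (HL : 0 <= L) by (repeat apply Rdiv_le_0_compat; lra).
  assert (Hlocal : forall p, 0 < p <= r -> exists mu1, 0 < mu1 <= mu0 /\
    forall mu, Rabs mu < mu1 -> exists qm qp : R, qm < 0 < qp /\
      differentiably_conjugate (fun x => f x mu) (open_interval (-p) p)
        (fun y => g y (nu mu) (sL mu) (sR mu) 0) (open_interval qm qp) /\
      exp (- (2 * L * p)) * p <= Rabs qm <= exp (2 * L * p) * p /\
      exp (- (2 * L * p)) * p <= Rabs qp <= exp (2 * L * p) * p).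
  { intros p Hp.
    (* The two terms keep [nu mu] and [xs mu], respectively, inside [[-p, p]]; [K + 1] avoids
       division by zero. *)
    set (c := Rmin (p / (K + 1)) (p * d / (K + 1))).
    assert (Hc : 0 < c) by (apply Rmin_glb_lt; apply Rdiv_lt_0_compat; nra).
    assert (Hc1 : (K + 1) * c <= p).
    { apply Rle_trans with ((K + 1) * (p / (K + 1))).
      - apply Rmult_le_compat_l; [lra|apply Rmin_l].
      - apply Req_le. field. lra. }
    assert (Hc2 : (K + 1) * c <= p * d).
    { apply Rle_trans with ((K + 1) * (p * d / (K + 1))).
      - apply Rmult_le_compat_l; [lra|apply Rmin_r].
      - apply Req_le. field. lra. }
    exists (Rmin mu0 c). split; [split; [apply Rmin_glb_lt; lra|apply Rmin_l]|].
    intros mu Hmu. pose proof (Rmin_l mu0 c). pose proof (Rmin_r mu0 c).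
    assert (Hmu' : Rabs mu < mu0) by lra. assert (Hmur : Rabs mu <= r) by lra.
    destruct (Hxs mu Hmu') as [_ [Hfix [Hxsb _]]]. pose proof (Rabs_pos mu).
    assert (Hr' : forall x, -p <= x <= p -> Rabs x <= r)
      by (intros x Hx; apply Rabs_le; lra).
    apply (conjugacy_near_kink (fun x => f x mu) (fun x => fL x mu) (fun x => fR x mu)
      (fun x => AL x mu) (fun x => AR x mu) p d K rho (nu mu) (xs mu)); try assumption.
    - lra.
    - unfold nu. rewrite (proj1 (Hf 0 mu H0r Hmur)) by lra.
      apply Rle_trans with (K * Rabs mu); [apply (BL 0 mu H0r Hmur)|nra].
    - apply Rabs_le_between. apply Rmult_le_reg_l with d; [lra|].
      apply Rle_trans with (1 := Hxsb). nra.
    - intros x Hx. split; [apply (BL x mu)|apply (BR x mu)]; auto.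
    - intros x Hx. split; [apply HAL|apply HAR]; auto.
    - intros x Hx. specialize (Hr' x Hx).
      (* The slopes at [0] and at [x] both have the sign of the limiting slope, hence the same
         sign. *)
      assert (Hsq : forall a b c, 0 < a * b -> 0 < a * c -> 0 < b * c).
      { intros a b e Hab Hae. assert (a <> 0) by (intros ->; lra).
        assert (0 < a * a) by nra. nra. }
      split.
      + apply Hsq with aL; now apply HAL.
      + apply Hsq with aR; now apply HAR.
    - intros x y Hx Hy. apply HAlip; [exact Hmur|lra|lra].
    - apply Hhyp. intros x Hx.
      split; [apply (BL x mu)|apply (BR x mu)]; auto.
    - symmetry. apply (Hf 0 mu H0r Hmur). lra.
    - symmetry. apply (Hf 0 mu H0r Hmur). lra.
    - intros x Hx. apply Hf; auto. }
  assert (Hdelta : forall delta, 0 < delta -> exists mu1 p, 0 < mu1 <= mu0 /\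
    0 < p <= r /\ exists qm qp : R -> R, forall mu, Rabs mu < mu1 ->
      qm mu < 0 < qp mu /\
      differentiably_conjugate (fun x => f x mu) (open_interval (- p) p)
        (fun y => g y (nu mu) (sL mu) (sR mu) 0) (open_interval (qm mu) (qp mu)) /\
      (1 - delta) * p < Rabs (qm mu) < (1 + delta) * p /\
      (1 - delta) * p < Rabs (qp mu) < (1 + delta) * p).
  { intros delta Hdel.
    set (l := ln (1 + delta)).
    assert (Hl : 0 < l) by (unfold l; rewrite <- ln_1; apply ln_increasing; lra).
    assert (Hexpl : exp l = 1 + delta) by (apply exp_ln; lra).
    (* This gives [2 * L * p < ln (1 + delta)], hence the upper bound; the lower one follows from
       [exp (- t) >= 1 - t] and [ln (1 + delta) <= delta]. *)
    set (p := Rmin r (l / (2 * L + 1))).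
    assert (Hp : 0 < p <= r).
    { split; [|apply Rmin_l]. apply Rmin_glb_lt; [lra|apply Rdiv_lt_0_compat; lra]. }
    assert (Hlp : 2 * L * p < l).
    { assert ((2 * L + 1) * p <= l).
      { apply Rle_trans with ((2 * L + 1) * (l / (2 * L + 1))).
        - apply Rmult_le_compat_l; [lra|apply Rmin_r].
        - apply Req_le. field. lra. }
      lra. }
    assert (Hup : exp (2 * L * p) < 1 + delta)
      by (rewrite <- Hexpl; now apply exp_increasing).
    assert (Hlow : 1 - delta < exp (- (2 * L * p))).
    { pose proof (exp_ineq1_le (- (2 * L * p))). pose proof (exp_ineq1_le l). lra. }
    destruct (Hlocal p Hp) as [mu1 [Hmu1 Hq]].
    (* Both end points are chosen together as a pair, with [(0, 0)] as default for large [mu]. *)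
    assert (Hq' : forall mu, exists q : R * R, Rabs mu < mu1 -> fst q < 0 < snd q /\
      differentiably_conjugate (fun x => f x mu) (open_interval (-p) p)
        (fun y => g y (nu mu) (sL mu) (sR mu) 0) (open_interval (fst q) (snd q)) /\
      (1 - delta) * p < Rabs (fst q) < (1 + delta) * p /\
      (1 - delta) * p < Rabs (snd q) < (1 + delta) * p).
    { intros mu. destruct (Rlt_dec (Rabs mu) mu1) as [Hmu|Hmu]; [|exists (0, 0); lra].
      destruct (Hq mu Hmu) as [qm [qp [H1 [H2 [H3 H4]]]]].
      exists (qm, qp). intros _. simpl.
      split; [exact H1|split; [exact H2|]].
      split; split; nra. }
    set (q := fun mu => proj1_sig (constructive_indefinite_description _ (Hq' mu))).
    exists mu1, p. split; [exact Hmu1|split; [exact Hp|]].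
    exists (fun mu => fst (q mu)), (fun mu => snd (q mu)). intros mu.
    unfold q. now destruct (constructive_indefinite_description _ _). }
  assert (Habs : forall a mu, - a < mu < a -> Rabs mu < a)
    by (intros; now apply Rabs_def1).
  assert (HpO : forall p, p <= r -> forall x, open_interval (- p) p x -> Omega x).
  { intros p Hp x Hx. unfold open_interval in Hx. apply HO', Rabs_le. lra. }
  (* The choice [delta = 1] supplies [N], [M] and the theorem's [mu0]; later values of [delta] take
     the minimum with this radius. *)
  destruct (Hdelta 1 Rlt_0_1) as [mu1 [p [Hmu1 [Hp [qm [qp Hq]]]]]].
  exists mu1, sL, sR, (open_interval (- p) p),
    (fun mu => open_interval (qm mu) (qp mu)).
  split; [lra|]. split; [|split; [|split; [|split; [|split; [|split; [|split; [|split]]]]]]].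
  - intros mu Hmu. apply HJ'. apply Habs in Hmu. lra.
  - intros mu Hmu. apply Hsc. apply Habs in Hmu. lra.
  - apply perturbed_slope_bigO with K (2 * K / d * (K / d)) mu0; [lra| |exact HE].
    intros mu Hmu. apply (BL 0 mu H0r). lra.
  - apply perturbed_slope_bigO with K (2 * K / d * (K / d)) mu0; [lra| |exact HE].
    intros mu Hmu. apply (BR 0 mu H0r). lra.
  - apply is_open_interval_bounded.
  - unfold open_interval. lra.
  - apply HpO. lra.
  - intros mu Hmu. destruct (Hq mu (Habs _ _ Hmu)) as [H1 [H2 _]].
    split; [apply is_open_interval_bounded|split; [exact H1|exact H2]].
  - intros delta Hdel. destruct (Hdelta delta Hdel)
      as [mu2 [p2 [Hmu2 [Hp2 [qm2 [qp2 Hq2]]]]]].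
    exists (Rmin mu1 mu2), p2, qm2, qp2.
    split; [split; [apply Rmin_glb_lt; lra|apply Rmin_l]|].
    split; [lra|split; [apply HpO; lra|]].
    intros mu Hmu. apply Hq2. apply Habs in Hmu.
    pose proof (Rmin_r mu1 mu2). lra.
Qed.
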